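(* Let $E$ be a finite set. The following hold. (1) (Identity) Let $\mathscr{C}_{\mathrm{id}}$ be the matroid on $E\sqcup E^*$ with bases $\{S\sqcup(E\setminus S)^*\mid S\subseteq E\}$. Then $\mathscr{C}_{\mathrm{id}*}(M)=M^*$ for every $M\in\mathrm{Mat}(E)$. (2) (Permutation of the ground set) For any permutation $\sigma$ of $E$, let $\mathscr{C}_\sigma$ be the matroid on $E\sqcup E^*$ with bases $\{S\sqcup(E\setminus\sigma(S))^*\mid S\subseteq E\}$. Then $\mathscr{C}_{\sigma*}(M)=\sigma(M)^*$ for every $M\in\mathrm{Mat}(E)$, where $\sigma(M)$ is the matroid on $E$ with bases $\{\sigma(B)\mid B\in\mathcal{B}_M\}$. (3) (Deletion) For any $e\in E$, let $\mathscr{C}_{\setminus e}:=\mathscr{C}_{\mathrm{id}}\setminus e^*$, the matroid on $E\sqcup(E\setminus\{e\})^*$ with bases $\{S\sqcup(E\setminus S)^*\mid e\in S\subseteq E\}$. Then $\mathscr{C}_{\setminus e*}(M)=(M\setminus e)^*$ for every $M\in\mathrm{Mat}(E)$. (4) (Contraction) For any $e\in E$, let $\mathscr{C}_{/e}:=\mathscr{C}_{\mathrm{id}}/e^*$, the matroid on $E\sqcup(E\setminus\{e\})^*$ with bases $\{S\sqcup(E\setminus(S\cup\{e\}))^*\mid S\subseteq E\setminus\{e\}\}$. Then $\mathscr{C}_{/e*}(M)=(M/e)^*$ for every $M\in\mathrm{Mat}(E)$. (5) (Free extension) For $t\notin E$, let $\mathscr{C}_{+t}:=\mathscr{C}_{\mathrm{id}}+_{E\sqcup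 E^*}t$, the matroid on $E\sqcup E^*\sqcup\{t\}$ with bases $\{S\sqcup(E\setminus S)^*\mid S\subseteq E\}\cup\{S\sqcup(E\setminus(S\cup\{e\}))^*\sqcup\{t\}\mid S\subseteq E,\ e\in E\setminus S\}$. Then $\mathscr{C}_{+t*}(M)=(M+_E t)^*$ for every $M\in\mathrm{Mat}(E)$. (6) (Intersection with a fixed matroid) For any matroid $M_0$ on $E$, let $\mathscr{C}_{\wedge M_0}:=\mathscr{C}_{\mathrm{id}}\wedge(M_0\oplus\mathbf{B}_{E^*})$, a matroid on $E\sqcup E^*$. Then $\mathscr{C}_{\wedge M_0*}(M)=(M\wedge M_0)^*$ for every $M\in\mathrm{Mat}(E)$. (7) (Union with a fixed matroid) For any matroid $M_0$ on $E$, let $\mathscr{C}_{\vee M_0}:=\mathscr{C}_{\mathrm{id}}\vee(M_0\oplus U_{0,E^*})$, a matroid on $E\sqcup E^*$. Then $\mathscr{C}_{\vee M_0*}(M)=(M\vee M_0)^*$ for every $M\in\mathrm{Mat}(E)$. (8) (Constant map) Let $E_1,E_2$ be (disjoint) finite sets. For any matroid $M_0$ on $E_2$, let $\mathscr{C}_{M_0}:=\mathbf{B}_{E_1}\oplus M_0$. Then $\mathscr{C}_{M_0*}(M)=M_0$ for every $M\in\mathrm{Mat}(E_1)$.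
   Context: All matroids are on finite ground sets. $\mathrm{Mat}(E)$ denotes the poset category of matroids on $E$, whose morphisms are matroid quotients ($N$ is a quotient of $M$ if every flat of $N$ is a flat of $M$). $\mathcal{B}_M$ is the set of bases of $M$. For matroids $M,N$ on the same ground set $E$: the union $M\vee N$ is the matroid whose independent sets are the sets $I\cup J$ with $I$ independent in $M$ and $J$ independent in $N$; the intersection $M\wedge N$ is the dual of the union of the duals of $M$ and $N$, equivalently the matroid whose bases are the inclusion-minimal sets among $\{B\cap B' : B\in\mathcal{B}_M,\ B'\in\mathcal{B}_N\}$. $\mathbf{B}_{E}$ is the Boolean matroid on $E$ (only basis $E$); $U_{r,E}$ is the uniform matroid of rank $r$ on $E$; $\oplus$, $\setminus$, $/$ denote direct sum, deletion, contraction. For disjoint finite sets $E_1,E_2$ and a matroid $\mathscr{C}$ on $E_1\sqcup E_2$, the matroid correspondence $\mathscr{C}_*:\mathrm{Mat}(E_1)\to\mathrm{Mat}(E_2)$ is $\mathscr{C}_*(M):=\big((M\oplus \mathbf{B}_{E_2})\wedge \mathscr{C}\big)\setminus E_1$. $E^*$ is a set disjoint from $E$ with a natural bijection $e\mapsto e^*$; for $A\subseteq E$, $A^*=\{a^*: a\in A\}$, and for a matroid $M$ on $A\subseteq E$, $M^*$ denotes the copy of $M$ on $A^*$ obtained via this bijection (not the dual matroid). In (3) and (4) the correspondence goes from $E$ to $(E\setminus\{e\})^*$; in (5) it goes from $E$ to $E^*\sqcup\{t\}$, and $(M+_E t)^*$ is the copy of $M+_E t$ on $E^*\sqcup\{t\}$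 ($t$ is kept unchanged). The free extension $M+_E t$ of a matroid $M$ on $E$ by $t\notin E$ is the matroid on $E\sqcup\{t\}$ with bases $\mathcal{B}_M\cup\{(B\setminus\{e\})\cup\{t\}: B\in\mathcal{B}_M, e\in B\}$. *)

(* Defs.v *)
From HB Require Import structures.
From mathcomp Require Import all_boot fingroup perm.
From mathcomp Require Import zify.
Set Implicit Arguments.
Unset Strict Implicit.
Unset Printing Implicit Defensive.

(* A matroid carries its own ground set, a subset of an ambient finite type,
   so that operations changing the ground set need no transport. *)

Definition basis_axiom (T : finType) (G : {set T}) (Bs : {set {set T}}) :=
  [&& Bs != set0, [forall B in Bs, B \subset G] &
    [forall B1 in Bs, forall B2 in Bs, forall x in B1 :\: B2,
      exists y in B2 :\: B1, (y |: (B1 :\ x)) \in Bs]].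

Record matroid (T : finType) := Matroid {
  matroid_val : {set T} * {set {set T}};
  _ : basis_axiom matroid_val.1 matroid_val.2 }.

HB.instance Definition _ (T : finType) := [isSub for @matroid_val T].

Definition ground (T : finType) (M : matroid T) : {set T} := (val M).1.
Definition bases (T : finType) (M : matroid T) : {set {set T}} := (val M).2.

Definition indep (T : finType) (M : matroid T) : {set {set T}} :=
  [set I : {set T} | [exists B in bases M, I \subset B]].

Lemma matroid_eq (T : finType) (M N : matroid T) :
  ground M = ground N -> bases M = bases N -> M = N.
Proof.
rewrite /ground /bases => h1 h2; apply: val_inj.
by case: (val M) (val N) h1 h2 => a b [c d] /= -> ->.
Qed.

Lemma trivial_basis_axiom (T : finType) (G : {set T}) :
  basis_axiom G [set set0].
Proof.
apply/and3P; split.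
- by apply/set0Pn; exists set0; rewrite inE.
- by apply/forall_inP => B; rewrite inE => /eqP ->; exact: sub0set.
- apply/forall_inP => B1; rewrite inE => /eqP ->; apply/forall_inP => B2 _.
  by apply/forall_inP => x; rewrite !inE andbF.
Qed.

(* The matroid on G with set of bases Bs.  When Bs is not the set of bases of a
   matroid on G the value is a dummy, the matroid on G of rank 0; the lemmas
   below show that the dummy value is never reached by the operations on
   matroids in their domain of definition. *)
Definition of_bases (T : finType) (G : {set T}) (Bs : {set {set T}}) :
    matroid T :=
  insubd (@Matroid T (G, [set set0]) (trivial_basis_axiom G)) (G, Bs).

Lemma ground_of_bases (T : finType) (G : {set T}) (Bs : {set {set T}}) :
  ground (of_bases G Bs) = G.
Proof. by rewrite /ground /of_bases val_insubd; case: ifP. Qed.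

Lemma bases_of_bases (T : finType) (G : {set T}) (Bs : {set {set T}}) :
  basis_axiom G Bs -> bases (of_bases G Bs) = Bs.
Proof. by rewrite /bases /of_bases val_insubd /= => ->. Qed.

Definition maximal_sets (T : finType) (F : {set {set T}}) : {set {set T}} :=
  [set B | maxset [pred K | K \in F] B].

Definition mdual (T : finType) (M : matroid T) : matroid T :=
  of_bases (ground M) [set ground M :\: B | B in bases M].

Definition union_indep (T : finType) (M N : matroid T) : {set {set T}} :=
  [set I :|: J | I in indep M, J in indep N].

Definition munion (T : finType) (M N : matroid T) : matroid T :=
  of_bases (ground M :|: ground N) (maximal_sets (union_indep M N)).

Definition minter (T : finType) (M N : matroid T) : matroid T :=
  mdual (munion (mdual M) (mdual N)).

(* Meaningful when ground M and ground N are disjoint. *)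
Definition mdsum (T : finType) (M N : matroid T) : matroid T :=
  of_bases (ground M :|: ground N)
           [set B :|: B' | B in bases M, B' in bases N].

(* Deletion of A: the restriction of M to the complement of A. *)
Definition mdelete (T : finType) (M : matroid T) (A : {set T}) : matroid T :=
  of_bases (ground M :\: A) (maximal_sets [set B :\: A | B in bases M]).

Definition mcontract (T : finType) (M : matroid T) (A : {set T}) : matroid T :=
  mdual (mdelete (mdual M) A).

(* U_{r,E}; meaningful when r <= #|E|. *)
Definition muniform (T : finType) (r : nat) (E : {set T}) : matroid T :=
  of_bases E [set B : {set T} | (B \subset E) && (#|B| == r)].

Definition mboolean (T : finType) (E : {set T}) : matroid T :=
  of_bases E [set E].

(* The copy of M along f; meaningful when f is injective on ground M. *)
Definition mimage (T T' : finType) (f : T -> T') (M : matroid T) : matroid T' :=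
  of_bases (f @: ground M) [set f @: (B : {set T}) | B in bases M].

(* Meaningful when t is not in ground M. *)
Definition mfree_ext (T : finType) (M : matroid T) (t : T) : matroid T :=
  of_bases (t |: ground M)
    (bases M :|: [set t |: (B :\ e) | B in bases M, e in B]).

(* The matroid correspondence C_* for C on the disjoint union of E1 and E2 and
   M on E1. *)
Definition mcorr (T : finType) (E1 E2 : {set T}) (C M : matroid T) :
    matroid T :=
  mdelete (minter (mdsum M (mboolean E2)) C) E1.

(* Below E^* is star @: E, where star is injective on E and E and star @: E are
   disjoint. *)

Definition corr_id (T : finType) (E : {set T}) (star : T -> T) : matroid T :=
  of_bases (E :|: star @: E)
           [set S :|: star @: (E :\: S) | S in powerset E].

Definition corr_perm (T : finType) (E : {set T}) (star : T -> T)
    (s : {perm T}) : matroid T :=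
  of_bases (E :|: star @: E)
           [set S :|: star @: (E :\: s @: S) | S in powerset E].

(* The operations are well defined. *)

Section MatroidFacts.
Variable T : finType.
Implicit Types (M N : matroid T) (A B I J : {set T}).

Lemma basis_axiomP M : basis_axiom (ground M) (bases M).
Proof. exact: valP M. Qed.

Lemma bases_neq0 M : exists B, B \in bases M.
Proof. by case/and3P: (basis_axiomP M) => /set0Pn. Qed.

Lemma bases_sub M B : B \in bases M -> B \subset ground M.
Proof. by case/and3P: (basis_axiomP M) => _ /forall_inP h _; apply: h. Qed.

Lemma bases_exchange M B1 B2 x :
  B1 \in bases M -> B2 \in bases M -> x \in B1 -> x \notin B2 ->
  exists y, [/\ y \in B2, y \notin B1 & (y |: (B1 :\ x)) \in bases M].
Proof.
move=> h1 h2 x1 x2.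
case/and3P: (basis_axiomP M) => _ _ /forall_inP /(_ _ h1) /forall_inP.
move=> /(_ _ h2) /forall_inP /(_ x); rewrite inE x1 x2 => /(_ isT).
by case/exists_inP=> y; rewrite inE => /andP[? ?] ?; exists y.
Qed.

Lemma cards_swap B (x y : T) :
  x \in B -> y \notin B -> #|y |: (B :\ x)| = #|B|.
Proof.
move=> xB yB; rewrite cardsU1 !inE (negbTE yB) andbF /=.
by rewrite [RHS](cardsD1 x) xB.
Qed.

Lemma card_bases M B1 B2 : B1 \in bases M -> B2 \in bases M -> #|B1| = #|B2|.
Proof.
suff le C1 C2 : C1 \in bases M -> C2 \in bases M -> #|C1| <= #|C2|.
  by move=> h1 h2; apply/eqP; rewrite eqn_leq !le.
elim: {C1}_.+1 {-2}C1 (ltnSn #|C1 :\: C2|) => // n IHn C1 le_n h1 h2.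
have [/eqP|[x]] := set_0Vmem (C1 :\: C2).
  by rewrite setD_eq0 => /subset_leq_card.
rewrite inE => /andP[x2 x1].
have [y [y2 y1 hy]] := bases_exchange h1 h2 x1 x2.
rewrite -(cards_swap x1 y1); apply: IHn hy h2; move: le_n; rewrite !ltnS.
apply: leq_trans; apply: proper_card; apply/properP; split.
  apply/subsetP=> z; rewrite !inE => /andP[z2 /orP[/eqP e|/andP[_ ->]]].
    by rewrite e y2 in z2.
  by rewrite z2.
by exists x; rewrite !inE ?x2 ?x1 //= eqxx /= orbF; apply: contraNneq y1 => <-.
Qed.

Lemma indepP M I :
  reflect (exists2 B, B \in bases M & I \subset B) (I \in indep M).
Proof. by rewrite inE; apply: exists_inP. Qed.

Lemma indep_sub M I J : I \subset J -> J \in indep M -> I \in indep M.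
Proof.
by move=> IJ /indepP[B hB JB]; apply/indepP; exists B; rewrite ?(subset_trans IJ).
Qed.

Lemma bases_indep M B : B \in bases M -> B \in indep M.
Proof. by move=> hB; apply/indepP; exists B. Qed.

Lemma indep_ground M I : I \in indep M -> I \subset ground M.
Proof. by case/indepP=> B /bases_sub h1 h2; apply: subset_trans h1. Qed.

Lemma indep0 M : set0 \in indep M.
Proof. by have [B hB] := bases_neq0 M; apply/indepP; exists B; rewrite ?sub0set. Qed.

Lemma indep_card M I B : I \in indep M -> B \in bases M ->
  (#|I| <= #|B|) * ((#|I| == #|B|) = (I \in bases M)).
Proof.
case/indepP=> B' hB' IB' hB; rewrite (card_bases hB hB').
split; first exact: subset_leq_card.
apply/idP/idP => [e|h]; last by rewrite (card_bases h hB').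
by have /eqP -> : I == B' by rewrite eqEcard IB' (eqP e) leqnn.
Qed.

Lemma indep_aug M I J : I \in indep M -> J \in indep M -> #|I| < #|J| ->
  exists e, [/\ e \in J, e \notin I & e |: I \in indep M].
Proof.
move=> /indepP[B1 h1 IB1] /indepP[B2 h2 JB2] ltIJ.
case: (boolP [exists e in J :\: I, e |: I \in indep M]).
  by case/exists_inP=> e; rewrite inE => /andP[? ?] ?; exists e.
move/exists_inPn => noaug0; exfalso.
have noaug y : y \in J -> y \notin I -> y |: I \in indep M -> False.
  by move=> yJ yI; apply/negP/noaug0; rewrite inE yI yJ.
have JB1 : J :&: B1 \subset I.
  apply/subsetP=> z; rewrite inE => /andP[zJ zB1]; apply/negPn/negP => zI.
  apply: (noaug z) => //.
  by apply/indepP; exists B1; rewrite // subUset sub1set zB1.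
have {B2 h2 JB2} [B2 [h2 JB2 sB2]] :
    exists B, [/\ B \in bases M, J \subset B & B \subset J :|: B1].
  elim: {B2}_.+1 {-2}B2 (ltnSn #|B2 :\: (J :|: B1)|) h2 JB2 => // n IHn B2 le_n h2 JB2.
  have [/eqP|[x]] := set_0Vmem (B2 :\: (J :|: B1)).
    by rewrite setD_eq0 => s; exists B2.
  rewrite !inE negb_or => /andP[/andP[xJ xB1] xB2].
  have [y [y1 y2 hy]] := bases_exchange h2 h1 xB2 xB1.
  apply: IHn hy _.
    move: le_n; rewrite !ltnS.
    apply: leq_trans; apply: proper_card; apply/properP; split.
      apply/subsetP=> z; rewrite !inE => /andP[z2 /orP[/eqP e|/andP[_ ->]]].
        by rewrite e y1 orbT in z2.
      by rewrite z2.
    exists x; rewrite !inE ?(negbTE xJ) ?(negbTE xB1) ?xB2 //= eqxx /= orbF.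
    by apply: contraNneq y2 => <-.
  apply/subsetP=> z zJ; rewrite !inE (subsetP JB2) // andbT.
  by apply/orP; right; apply: contraNneq xJ => <-.
have sB1 : B1 :\: B2 \subset I.
  apply/subsetP=> x; rewrite inE => /andP[x2 x1]; apply/negPn/negP => xI.
  have [y [y2 y1 hy]] := bases_exchange h1 h2 x1 x2.
  have yJ : y \in J.
    by move: (subsetP sB2 y y2); rewrite inE (negbTE y1) orbF.
  have yI : y \notin I by apply: contra y1; apply: (subsetP IB1).
  apply: (noaug y) => //.
  apply/indepP; eexists; first exact: hy.
  apply/subsetP=> z; rewrite !inE => /orP[->//|zI].
  rewrite (subsetP IB1) // andbT; apply/orP; right.
  by apply: contraNneq xI => <-.
have le1 : #|B1 :\: B2| <= #|I :\: J|.
  apply: subset_leq_card; apply/subsetP=> z zB; rewrite inE (subsetP sB1) //.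
  rewrite andbT; move: zB; rewrite inE => /andP[zB _].
  by apply: contra zB; apply: (subsetP JB2).
have le2 : #|J :\: I| <= #|B2 :\: B1|.
  apply: subset_leq_card; apply/subsetP=> z; rewrite !inE => /andP[zI zJ].
  rewrite (subsetP JB2) // andbT; apply: contra zI => zB1.
  by apply: (subsetP JB1); rewrite inE zJ.
have := card_bases h1 h2.
have := cardsID B2 B1; have := cardsID B1 B2; rewrite [B2 :&: B1]setIC.
have := cardsID I J; have := cardsID J I; rewrite [J :&: I]setIC.
lia.
Qed.

Lemma indep_extend M I B : I \in indep M -> B \in bases M ->
  exists2 B', B' \in bases M & (I \subset B') && (B' \subset I :|: B).
Proof.
elim: {I}_.+1 {-2}I (ltnSn (#|B| - #|I|)) => // n IHn I le_n hI hB.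
have [le_I eq_I] := indep_card hI hB.
case: (ltngtP #|I| #|B|) => [lt|gt|e]; [|lia|].
  have [e [eB eI hE]] := indep_aug hI (bases_indep hB) lt.
  case: (IHn _ _ hE hB) => [|B' hB' /andP[s1 s2]].
    by rewrite cardsU1 eI; lia.
  exists B' => //; apply/andP; split.
    by apply: subset_trans s1; apply: subsetUr.
  apply: subset_trans s2 _; rewrite !subUset subsetUl subsetUr sub1set.
  by rewrite inE eB orbT.
by exists I; rewrite -?eq_I ?e ?eqxx // subxx subsetUl.
Qed.

Lemma basis_axiom_indep (G : {set T}) (F : {set {set T}}) :
  set0 \in F -> (forall I, I \in F -> I \subset G) ->
  (forall I J, I \subset J -> J \in F -> I \in F) ->
  (forall I J, I \in F -> J \in F -> #|I| < #|J| ->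
     exists e, [/\ e \in J, e \notin I & e |: I \in F]) ->
  basis_axiom G (maximal_sets F).
Proof.
move=> F0 FG Fh Fa.
have mF B : B \in maximal_sets F -> B \in F.
  by rewrite inE => /maxsetp.
have cle I B : I \in F -> B \in maximal_sets F -> #|I| <= #|B|.
  move=> hI hB; rewrite leqNgt; apply/negP => lt.
  have [e [_ eB he]] := Fa _ _ (mF _ hB) hI lt.
  move: hB; rewrite inE => /maxsetP[_ /(_ _ he (subsetUr _ _)) e1].
  by move/negP: eB; apply; rewrite -e1 !inE eqxx.
apply/and3P; split.
- have [B hB _] := @maxset_exists _ [pred K | K \in F] _ F0.
  by apply/set0Pn; exists B; rewrite inE.
- by apply/forall_inP => B /mF /FG.
- apply/forall_inP => B1 h1; apply/forall_inP => B2 h2.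
  apply/forall_inP => x; rewrite inE => /andP[x2 x1].
  have e12 : #|B1| = #|B2|.
    by apply/eqP; rewrite eqn_leq !cle ?mF.
  have [||e [eB eI he]] := Fa (B1 :\ x) B2 _ (mF _ h2).
  + by apply: Fh (mF _ h1); apply: subsetDl.
  + by rewrite -e12 [#|B1|](cardsD1 x) x1.
  have eB1 : e \notin B1.
    by apply: contra eI => eB1; rewrite !inE eB1 andbT; apply: contraNneq x2 => <-.
  apply/exists_inP; exists e; first by rewrite inE eB eB1.
  rewrite inE; apply/maxsetP; split=> // A hA sA; apply/eqP.
  by rewrite eq_sym eqEcard sA (cards_swap x1 eB1) cle.
Qed.

Lemma indep_of_indep (G : {set T}) (F : {set {set T}}) :
  set0 \in F -> (forall I, I \in F -> I \subset G) ->
  (forall I J, I \subset J -> J \in F -> I \in F) ->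
  (forall I J, I \in F -> J \in F -> #|I| < #|J| ->
     exists e, [/\ e \in J, e \notin I & e |: I \in F]) ->
  indep (of_bases G (maximal_sets F)) = F.
Proof.
move=> F0 FG Fh Fa; apply/setP => I; apply/indepP/idP.
  rewrite bases_of_bases; last exact: basis_axiom_indep.
  by case=> B; rewrite inE => /maxsetp /= hB sB; apply: Fh hB.
move=> hI; have [B hB sB] := @maxset_exists _ [pred K | K \in F] _ hI.
exists B => //; rewrite bases_of_bases; last exact: basis_axiom_indep.
by rewrite inE.
Qed.

Lemma bases_mdual M : bases (mdual M) = [set ground M :\: B | B in bases M].
Proof.
apply: bases_of_bases; apply/and3P; split.
- have [B hB] := bases_neq0 M; apply/set0Pn; exists (ground M :\: B).
  exact: imset_f.
- by apply/forall_inP => _ /imsetP[B _ ->]; apply: subsetDl.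
apply/forall_inP => _ /imsetP[B1 h1 ->]; apply/forall_inP => _ /imsetP[B2 h2 ->].
apply/forall_inP => x; rewrite !inE => /andP[x2 /andP[x1 xG]].
rewrite xG andbT negbK in x2.
have hI : x |: (B1 :&: B2) \in indep M.
  by apply/indepP; exists B2; rewrite // subUset sub1set x2 subsetIr.
have [B' hB' /andP[s1 s2]] := indep_extend hI h1.
have {}s2 : B' \subset x |: B1.
  by apply: subset_trans s2 _; rewrite !subUset subsetUl subsetUr subIset // subsetUr.
have xB' : x \in B' by apply: (subsetP s1); rewrite !inE eqxx.
have : #|(x |: B1) :\: B'| == 1.
  have := cardsID B' (x |: B1); rewrite (setIidPr s2) cardsU1 x1 (card_bases h1 hB').
  by move=> ?; apply/eqP; lia.
case/cards1P=> y ey.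
have : y \in (x |: B1) :\: B' by rewrite ey inE.
rewrite !inE => /andP[yB' /orP[/eqP e|yB1]]; first by rewrite e xB' in yB'.
have yB2 : y \notin B2.
  by apply: contra yB' => yB2; apply: (subsetP s1); rewrite !inE yB1 yB2 orbT.
apply/exists_inP; exists y.
  by rewrite !inE (subsetP (bases_sub h1)) // yB1 yB2.
apply/imsetP; exists B' => //; apply/setP => z.
have /setP /(_ z) := ey; rewrite !inE => ez.
have := subsetP s2 z; rewrite !inE => ez2.
case: (eqVneq z y) => [->|zy] /=.
  by rewrite yB' (subsetP (bases_sub h1)).
rewrite (negbTE zy) in ez.
case: (eqVneq z x) ez ez2 => [->|zx] /= ez ez2; first by rewrite xB'.
by move: ez ez2; case: (z \in B'); case: (z \in B1) => //= _ /(_ isT).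
Qed.


Lemma union_indep_step M N (I1 I2 J1 J2 : {set T}) :
  I1 \in indep M -> I2 \in indep N -> J1 \in indep M -> #|I1| < #|J1| ->
  [disjoint I1 & I2] -> [disjoint J1 & J2] ->
  (exists e, [/\ e \in J1, e \notin I1 :|: I2 & e |: I1 \in indep M]) \/
  (exists K1 K2, [/\ K1 \in indep M, K2 \in indep N, K1 :|: K2 = I1 :|: I2,
     [disjoint K1 & K2] &
     #|J1 :\: K1| + #|J2 :\: K2| < #|J1 :\: I1| + #|J2 :\: I2|]).
Proof.
move=> h1 h2 hJ lt dI dJ.
have [e [eJ eI he]] := indep_aug h1 hJ lt.
case: (boolP (e \in I2)) => e2; last first.
  by left; exists e; rewrite inE negb_or eI.
right; exists (e |: I1), (I2 :\ e); split=> //.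
- by apply: indep_sub h2; apply: subsetDl.
- apply/setP => z; rewrite !inE; case: eqP => [->|_] /=; last by [].
  by rewrite e2 orbT.
- rewrite -setI_eq0; apply/eqP/setP => z; rewrite !inE.
  case: eqP => //= _; apply/negP => /andP[z1 z2].
  by move: dI; rewrite disjoint_subset => /subsetP /(_ z z1); rewrite !inE z2.
have -> : J2 :\: (I2 :\ e) = J2 :\: I2.
  apply/setP => z; rewrite !inE; case: eqP => [->|] //=.
  move: dJ; rewrite disjoint_subset => /subsetP /(_ e eJ); rewrite !inE.
  by move/negbTE=> ->; rewrite andbF.
rewrite ltn_add2r; apply: proper_card; apply/properP; split.
  by apply: setDS; apply: subsetUr.
by exists e; rewrite !inE ?eI // eqxx.
Qed.

Lemma union_indepC M N : union_indep M N = union_indep N M.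
Proof.
by apply/setP => K; apply/imset2P/imset2P => -[I J h1 h2 ->];
  exists J I; rewrite // setUC.
Qed.

Lemma union_indep_aug M N I J :
  I \in union_indep M N -> J \in union_indep M N -> #|I| < #|J| ->
  exists e, [/\ e \in J, e \notin I & e |: I \in union_indep M N].
Proof.
have disj K : K \in union_indep M N -> exists K1 K2,
    [/\ K1 \in indep M, K2 \in indep N, K = K1 :|: K2 & [disjoint K1 & K2]].
  case/imset2P => K1 K2 h1 h2 ->; exists K1, (K2 :\: K1); split=> //.
  - by apply: indep_sub h2; apply: subsetDl.
  - by apply/setP => z; rewrite !inE; case: (z \in K1).
  - by rewrite -setI_eq0; apply/eqP/setP => z; rewrite !inE; case: (z \in K1).
move=> /disj[I1 [I2 [hI1 hI2 eI dI]]] /disj[J1 [J2 [hJ1 hJ2 eJ dJ]]] lt.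
have [n le_n] := ubnP (#|J1 :\: I1| + #|J2 :\: I2|).
elim: n I1 I2 hI1 hI2 eI dI le_n => // n IHn I1 I2 hI1 hI2 eI dI.
rewrite ltnS => le_n.
have cU (A B : {set T}) : [disjoint A & B] -> #|A :|: B| = #|A| + #|B|.
  by move=> d; rewrite cardsU (disjoint_setI0 d) cards0 subn0.
have : (#|I1| < #|J1|) || (#|I2| < #|J2|).
  by move: lt; rewrite eI eJ !cU //; lia.
case/orP=> lt1.
  case: (union_indep_step hI1 hI2 hJ1 lt1 dI dJ).
    case=> e [e1 e2 e3]; exists e; rewrite eI eJ inE e1; split=> //.
    by rewrite setUA; apply: imset2_f.
  case=> K1 [K2 [k1 k2 eK dK ltK]]; apply: (IHn K1 K2) => //.
    by rewrite eK.
  by apply: leq_trans le_n.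
rewrite disjoint_sym in dI; rewrite disjoint_sym in dJ.
case: (union_indep_step hI2 hI1 hJ2 lt1 dI dJ).
  case=> e [e1 e2 e3]; exists e; rewrite eI eJ inE e1 orbT; split=> //.
    by rewrite setUC.
  by rewrite setUCA; apply: imset2_f.
case=> K1 [K2 [k1 k2 eK dK ltK]]; apply: (IHn K2 K1) => //.
- by rewrite setUC eK setUC.
- by rewrite disjoint_sym.
by rewrite addnC; apply: leq_trans ltK _; rewrite addnC.
Qed.

Lemma union_indep0 M N : set0 \in union_indep M N.
Proof. by rewrite -(setU0 set0); apply: imset2_f; apply: indep0. Qed.

Lemma union_indep_ground M N I :
  I \in union_indep M N -> I \subset ground M :|: ground N.
Proof. by case/imset2P=> A B /indep_ground hA /indep_ground hB ->; apply: setUSS. Qed.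

Lemma union_indep_sub M N I J :
  I \subset J -> J \in union_indep M N -> I \in union_indep M N.
Proof.
move=> IJ /imset2P[A B hA hB eJ].
have -> : I = (I :&: A) :|: (I :&: B) by rewrite -setIUr -eJ (setIidPl IJ).
by apply: imset2_f; [apply: indep_sub hA|apply: indep_sub hB]; apply: subsetIr.
Qed.


Lemma bases_munion M N :
  bases (munion M N) = maximal_sets (union_indep M N).
Proof.
apply: bases_of_bases; apply: basis_axiom_indep.
- exact: union_indep0.
- exact: union_indep_ground.
- exact: union_indep_sub.
- exact: union_indep_aug.
Qed.

Lemma indep_munion M N : indep (munion M N) = union_indep M N.
Proof.
apply: indep_of_indep.
- exact: union_indep0.
- exact: union_indep_ground.
- exact: union_indep_sub.
- exact: union_indep_aug.
Qed.

Lemma maximal_sets_cofinal (F F' : {set {set T}}) :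
  F' \subset F -> (forall K, K \in F -> exists2 L, L \in F' & K \subset L) ->
  maximal_sets F = maximal_sets F'.
Proof.
move=> /subsetP sF cF; apply/setP => K; rewrite !inE.
apply/maxsetP/maxsetP => /= -[hK mK].
  have [L hL KL] := cF _ hK; have eL := mK _ (sF _ hL) KL.
  by rewrite -{1}eL; split=> // L' hL'; apply: mK; apply: sF.
split; first exact: sF.
move=> L hL KL; have [L' hL' LL'] := cF _ hL.
have eL' := mK _ hL' (subset_trans KL LL').
by apply/eqP; rewrite eqEsubset KL andbT -eL'.
Qed.

Lemma mdelete_indep M A (F := [set I in indep M | [disjoint I & A]]) :
  [/\ maximal_sets [set B :\: A | B in bases M] = maximal_sets F,
   basis_axiom (ground M :\: A) (maximal_sets F) &
   indep (of_bases (ground M :\: A) (maximal_sets F)) = F].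
Proof.
have FG I : I \in F -> I \subset ground M :\: A.
  by rewrite inE subsetD => /andP[/indep_ground -> ->].
have Fh I J : I \subset J -> J \in F -> I \in F.
  move=> IJ; rewrite inE => /andP[h d].
  by rewrite inE (disjointWl IJ d) andbT (indep_sub IJ h).
have F0 : set0 \in F by rewrite inE indep0 -setI_eq0 set0I eqxx.
have Fa I J : I \in F -> J \in F -> #|I| < #|J| ->
    exists e, [/\ e \in J, e \notin I & e |: I \in F].
  rewrite [I \in _]inE [J \in _]inE => /andP[hI dI] /andP[hJ dJ] lt.
  have [e [e1 e2 e3]] := indep_aug hI hJ lt; exists e; split=> //.
  rewrite inE e3 -setI_eq0 setIUl setU_eq0 !setI_eq0 dI andbT.
  by rewrite disjoints1 (disjointFr dJ e1).
split; [apply/esym/maximal_sets_cofinal|exact: basis_axiom_indep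
       |exact: indep_of_indep].
  apply/subsetP => _ /imsetP[B hB ->]; rewrite inE; apply/andP; split.
    by apply: indep_sub (bases_indep hB); apply: subsetDl.
  by rewrite -setI_eq0; apply/eqP/setP => z; rewrite !inE andbC andbA andbN.
move=> K; rewrite inE => /andP[/indepP[B hB KB] d].
by exists (B :\: A); [exact: imset_f|rewrite subsetD KB].
Qed.

Lemma bases_mdelete M A :
  bases (mdelete M A) = maximal_sets [set B :\: A | B in bases M].
Proof.
by case: (mdelete_indep M A) => e h _; rewrite bases_of_bases // e.
Qed.

Lemma indep_mdelete M A :
  indep (mdelete M A) = [set I in indep M | [disjoint I & A]].
Proof. by rewrite /mdelete; case: (mdelete_indep M A) => -> _ ->. Qed.

Lemma bases_mdsum M N : [disjoint ground M & ground N] ->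
  bases (mdsum M N) = [set B :|: B' | B in bases M, B' in bases N].
Proof.
move=> dis; apply: bases_of_bases; apply/and3P; split.
- have [[B hB] [B' hB']] := (bases_neq0 M, bases_neq0 N).
  by apply/set0Pn; exists (B :|: B'); apply: imset2_f.
- apply/forall_inP => _ /imset2P[B B' /bases_sub h /bases_sub h' ->].
  exact: setUSS.
have dMN B B' : B \in bases M -> B' \in bases N -> [disjoint B & B'].
  by move=> /bases_sub h /bases_sub h'; apply: disjointWl h (disjointWr h' dis).
apply/forall_inP => _ /imset2P[B1 C1 hB1 hC1 ->].
apply/forall_inP => _ /imset2P[B2 C2 hB2 hC2 ->].
apply/forall_inP => x; rewrite !inE negb_or => /andP[/andP[xB2 xC2]].
case/orP => x1.
- have [y [y2 y1 hy]] := bases_exchange hB1 hB2 x1 xB2.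
  apply/exists_inP; exists y.
    by rewrite !inE y2 (negbTE y1) (disjointFr (dMN _ _ hB2 hC1) y2).
  apply/imset2P; exists (y |: (B1 :\ x)) C1 => //.
  rewrite -setUA; congr (_ :|: _); apply/setP => z; rewrite !inE.
  by case: eqP => //= ->; rewrite (disjointFr (dMN _ _ hB1 hC1) x1).
have [y [y2 y1 hy]] := bases_exchange hC1 hC2 x1 xC2.
apply/exists_inP; exists y.
  by rewrite !inE y2 orbT (negbTE y1) (disjointFl (dMN _ _ hB1 hC2) y2).
apply/imset2P; exists B1 (y |: (C1 :\ x)) => //.
rewrite setUCA; congr (_ :|: _); apply/setP => z; rewrite !inE.
by case: eqP => //= ->; rewrite (disjointFl (dMN _ _ hB1 hC1) x1).
Qed.

Lemma bases_mboolean (E : {set T}) : bases (mboolean E) = [set E].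
Proof.
apply: bases_of_bases; apply/and3P; split.
- by apply/set0Pn; exists E; rewrite inE.
- by apply/forall_inP => B; rewrite inE => /eqP ->.
- apply/forall_inP => B1; rewrite inE => /eqP ->.
  apply/forall_inP => B2; rewrite inE => /eqP ->.
  by apply/forall_inP => x; rewrite !inE andNb.
Qed.

Lemma bases_muniform r (E : {set T}) : r <= #|E| ->
  bases (muniform r E) = [set B : {set T} | (B \subset E) && (#|B| == r)].
Proof.
move=> le_r; apply: bases_of_bases; apply/and3P; split.
- have : 0 < #|[set B : {set T} | (B \subset E) && (#|B| == r)]|.
    by rewrite cards_draws bin_gt0.
  by rewrite card_gt0.
- by apply/forall_inP => B; rewrite inE => /andP[].
- apply/forall_inP => B1; rewrite inE => /andP[s1 /eqP c1].
  apply/forall_inP => B2; rewrite inE => /andP[s2 /eqP c2].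
  apply/forall_inP => x; rewrite inE => /andP[x2 x1].
  have /set0Pn[y] : B2 :\: B1 != set0.
    rewrite -card_gt0; have : 0 < #|B1 :\: B2|.
      by rewrite card_gt0; apply/set0Pn; exists x; rewrite inE x2.
    have := cardsID B2 B1; have := cardsID B1 B2; rewrite [B2 :&: B1]setIC.
    lia.
  rewrite inE => /andP[y1 y2]; apply/exists_inP; exists y.
    by rewrite inE y1.
  rewrite inE (cards_swap x1 y1) c1 eqxx andbT subUset sub1set.
  by rewrite (subsetP s2) // (subset_trans (subsetDl _ _)).
Qed.

Lemma bases_mfree_ext M t : t \notin ground M ->
  bases (mfree_ext M t) =
  bases M :|: [set t |: (B :\ e) | B in bases M, e in B].
Proof.
move=> tM; set X := [set t |: (B :\ e) | B in bases M, e in B].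
have [B0 hB0] := bases_neq0 M.
have tI I : I \in indep M -> t \notin I.
  by move=> /indep_ground /subsetP s; apply: contra tM; apply: s.
have tB B : B \in bases M -> t \notin B by move/bases_indep/tI.
have inX I : I \in indep M -> #|I|.+1 = #|B0| -> t |: I \in X.
  move=> hI cI; have [e [eB eI /indepP[B hB sB]]] : exists e,
    [/\ e \in B0, e \notin I & e |: I \in indep M].
    by apply: indep_aug => //; [exact: bases_indep|lia].
  apply/imset2P; exists B e => //; first by rewrite (subsetP sB) // !inE eqxx.
  congr (_ |: _); apply/eqP; rewrite eqEcard; apply/andP; split.
    by rewrite subsetD1 eI (subset_trans (subsetUr _ _) sB).
  have := cardsD1 e B; rewrite (subsetP sB) ?(card_bases hB hB0); last first.
    by rewrite !inE eqxx.
  by move=> h; rewrite -ltnS cI h.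
have Xin K : K \in X ->
    exists I, [/\ I \in indep M, #|I|.+1 = #|B0| & K = t |: I].
  case/imset2P => B e hB eB ->; exists (B :\ e); split=> //.
    by apply: indep_sub (bases_indep hB); apply: subsetDl.
  by rewrite (card_bases hB0 hB) (cardsD1 e B) eB.
apply: bases_of_bases; apply/and3P; split.
- by apply/set0Pn; exists B0; rewrite inE hB0.
- apply/forall_inP => B; rewrite inE => /orP[/bases_sub h|/Xin[I [hI _ ->]]].
    by apply: subset_trans h (subsetUr _ _).
  exact: setUS (indep_ground hI).
apply/forall_inP => B1; rewrite inE => h1; apply/forall_inP => B2.
rewrite inE => h2; apply/forall_inP => x; rewrite inE => /andP[x2 x1].
case/orP: h1 => [h1|/Xin[I [hI cI e1]]].
  case/orP: h2 => [h2|/Xin[J [hJ cJ e2]]].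
    have [y [y2 y1 hy]] := bases_exchange h1 h2 x1 x2.
    by apply/exists_inP; exists y; rewrite inE ?y1 // hy.
  apply/exists_inP; exists t; first by rewrite inE tB // e2 !inE eqxx.
  rewrite inE; apply/orP; right; apply: inX.
    by apply: indep_sub (bases_indep h1); apply: subsetDl.
  by rewrite (card_bases hB0 h1) (cardsD1 x B1) x1.
have eD : (t |: I) :\ t = I by rewrite setU1K // tI.
case: (eqVneq x t) => [ext|xt].
  have hB2 : B2 \in bases M.
    case/orP: h2 => // /Xin[J [_ _ e2]]; move: x2.
    by rewrite ext e2 !inE eqxx.
  have [|y [yB yI hy]] := indep_aug hI (bases_indep hB2).
    by rewrite (card_bases hB2 hB0) -cI.
  apply/exists_inP; exists y.
    rewrite inE yB e1 !inE negb_or yI !andbT.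
    by apply: contraTneq yB => ->; apply: tB.
  rewrite inE ext e1 eD -(indep_card hy hB0).2 cardsU1 yI -cI add1n eqxx.
  by [].
have xI : x \in I by move: x1; rewrite e1 !inE (negbTE xt).
have [J [hJ cJ sJ tJ]] : exists J, [/\ J \in indep M, #|I| <= #|J|,
    J \subset B2 & t |: B2 \subset t |: J].
  case/orP: h2 => [h2|/Xin[J [hJ cJ ->]]].
    by exists B2; rewrite (card_bases h2 hB0) -cI leqnSn; split=> //; apply: bases_indep.
  exists J; rewrite subsetUr; split=> //; first by move: cI cJ; lia.
  by rewrite setUA setUid.
have hIx : I :\ x \in indep M by apply: indep_sub hI; apply: subsetDl.
have [|y [yJ yI hy]] := indep_aug hIx hJ.
  by move: cJ; rewrite (cardsD1 x I) xI.
have yx : y != x by apply: contraNneq x2 => <-; apply: (subsetP sJ).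
have yI' : y \notin I by move: yI; rewrite !inE yx.
have yt : y != t by apply: contraTneq yJ => ->; apply: tI.
apply/exists_inP; exists y.
  by rewrite inE (subsetP sJ) // e1 !inE negb_or yt yI'.
rewrite inE; apply/orP; right.
have -> : y |: (B1 :\ x) = t |: (y |: (I :\ x)).
  apply/setP => z; rewrite e1 !inE.
  by case: (eqVneq z t) => [->|_] //=; rewrite [t == x]eq_sym xt orbT.
by apply: inX => //; rewrite cardsU1 yI -cI (cardsD1 x I) xI.
Qed.

End MatroidFacts.

Lemma bases_mimage (T T' : finType) (f : T -> T') (M : matroid T) :
  {in ground M &, injective f} ->
  bases (mimage f M) = [set f @: (B : {set T}) | B in bases M].
Proof.
move=> finj; apply: bases_of_bases.
have fE B x : B \in bases M -> x \in ground M -> (f x \in f @: B) = (x \in B).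
  move=> /bases_sub /subsetP hB xG; apply/imsetP/idP => [[y yB e]|]; last by exists x.
  by rewrite (finj _ _ xG (hB _ yB) e).
apply/and3P; split.
- by have [B hB] := bases_neq0 M; apply/set0Pn; exists (f @: B); apply: imset_f.
- by apply/forall_inP => _ /imsetP[B /bases_sub hB ->]; apply: imsetS.
apply/forall_inP => _ /imsetP[B1 h1 ->]; apply/forall_inP => _ /imsetP[B2 h2 ->].
apply/forall_inP => _ /setDP[/imsetP[x x1 ->]].
have xG := subsetP (bases_sub h1) x x1.
rewrite fE // => x2; have [y [y2 y1 hy]] := bases_exchange h1 h2 x1 x2.
have yG := subsetP (bases_sub h2) y y2.
apply/exists_inP; exists (f y); first by rewrite inE !fE // y1.
apply/imsetP; exists (y |: (B1 :\ x)) => //.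
rewrite imsetU1; congr (_ |: _); apply/setP => z; rewrite !inE.
apply/andP/imsetP => [[zx /imsetP[u u1 ez]]|[u]].
  by exists u => //; rewrite !inE u1 andbT; apply: contraNneq zx => <-; rewrite ez.
rewrite !inE => /andP[ux u1] ->; split; last exact: imset_f.
apply: contraNneq ux => /finj -> //; exact: (subsetP (bases_sub h1)).
Qed.

(* Main.v *)
Require Import Defs.
From mathcomp Require Import all_boot fingroup perm.
Set Implicit Arguments.
Unset Strict Implicit.
Unset Printing Implicit Defensive.

(** The image of M under a correspondence C from E1 to E2 is defined by an
    intersection of matroids. Its bases are the minimal sets among the intersections
    of a basis of the direct sum of M and the Boolean matroid on E2 with a basis of
    C. Minimality is the only difficulty, and it disappears as soon as some pair of
    such bases covers the ground set: minimal sets are then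
    exactly the intersections of covering pairs, by counting (bases_minter_cover).
    If E1 is independent in C, a covering pair exists whatever M is, and one gets a criterion (indep_mcorrP): a subset I of E2 is independent
    in the image of M if and only if, for some basis B of M, the union of I and of
    the complement of B in E1 is independent in C.

    The identity correspondence has as bases the transversals of the pairs
    x, star x; the disjoint union of K and the copy of J is independent in it if and
    only if K and J are disjoint (pair_indep). With K the complement of a basis B,
    this reads J contained in B, so the image of M is its copy. Replacing star
    by its composite with a permutation gives the permuted copy, and the same
    criterion gives deletion, free extension, union with M0 and the constant map,
    each time by describing the independent sets of the correspondence.

    For contraction, E is not independent in the correspondence but it is
    coindependent, and a dual criterion holds (indep_mdual_mcorrP): X is
    coindependent in the image if and only if, for some basis B of M, the union of
    B and X is coindependent in C. As the identity correspondence is self-dual, this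
    is dual to the case of deletion. For the intersection with M0, neither
    hypothesis need hold, but intersection is associative and commutes with
    adding a Boolean summand, which reduces the claim to the identity. *)

(** * Duality, deletion, contraction and intersection *)

Section Generalities.
Variable T : finType.
Implicit Types (M N L : matroid T) (A B C D I J W : {set T}).

Lemma basis_of_card M B B0 :
  B \in indep M -> B0 \in bases M -> #|B0| <= #|B| -> B \in bases M.
Proof.
move=> hB hB0 le; have [le' <-] := indep_card hB hB0.
by rewrite eqn_leq le' le.
Qed.

(** Bases are equicardinal, so for an independent set a cardinal test replaces
    the comparison with its supersets. *)
Lemma basis_of_max_card M B :
  B \in indep M -> (forall I, I \in indep M -> #|I| <= #|B|) -> B \in bases M.
Proof.
move=> hB mB; have [B0 hB0] := bases_neq0 M.
exact: basis_of_card hB hB0 (mB _ (bases_indep hB0)).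
Qed.

Lemma basis_indep_eq M B I :
  B \in bases M -> I \in indep M -> B \subset I -> I = B.
Proof.
move=> hB hI BI; apply/esym/eqP; rewrite eqEcard BI.
by case: (indep_card hI hB).
Qed.

Lemma bases_maximal_indep M : bases M = maximal_sets (indep M).
Proof.
apply/setP => B; rewrite [RHS]inE; apply/idP/maxsetP => /= [hB|[hB mB]].
  by split; [exact: bases_indep|move=> I hI; exact: basis_indep_eq hB hI].
by case/indepP: (hB) => B' hB' s; rewrite -(mB _ (bases_indep hB') s).
Qed.

(** Two matroids are compared below by their independent sets, whose membership
    conditions are monotone and hence easier to match than those of bases. *)
Lemma eq_indep M N : ground M = ground N -> indep M =i indep N -> M = N.
Proof.
move=> eG /setP eI; apply: matroid_eq => //.
by rewrite !bases_maximal_indep eI.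
Qed.

Lemma ground_mdual M : ground (mdual M) = ground M.
Proof. exact: ground_of_bases. Qed.

Lemma ground_mdelete M A : ground (mdelete M A) = ground M :\: A.
Proof. exact: ground_of_bases. Qed.

Lemma ground_munion M N : ground (munion M N) = ground M :|: ground N.
Proof. exact: ground_of_bases. Qed.

Lemma ground_minter M N : ground (minter M N) = ground M :|: ground N.
Proof. by rewrite ground_mdual ground_munion !ground_mdual. Qed.

Lemma ground_mdsum M N : ground (mdsum M N) = ground M :|: ground N.
Proof. exact: ground_of_bases. Qed.

Lemma ground_mcontract M A : ground (mcontract M A) = ground M :\: A.
Proof. by rewrite ground_mdual ground_mdelete ground_mdual. Qed.

Lemma setDDK (G B : {set T}) : B \subset G -> G :\: (G :\: B) = B.
Proof. by move=> s; rewrite setDDr setDv set0U (setIidPr s). Qed.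

Lemma mdualK : involutive (@mdual T).
Proof.
move=> M; apply: matroid_eq; first by rewrite !ground_mdual.
rewrite !bases_mdual ground_mdual -imset_comp -[RHS]imset_id.
by apply: eq_in_imset => B /bases_sub s /=; rewrite setDDK.
Qed.

Lemma mem_bases_mdual M B :
  (B \in bases (mdual M)) = (B \subset ground M) && (ground M :\: B \in bases M).
Proof.
rewrite bases_mdual; apply/imsetP/andP => [[B' hB' ->]|[sB hB]].
  by rewrite subsetDl setDDK ?bases_sub.
by exists (ground M :\: B); rewrite // setDDK.
Qed.

Lemma indep_mdualP M I :
  reflect (exists2 B, B \in bases M & I \subset ground M :\: B)
          (I \in indep (mdual M)).
Proof.
apply: (iffP (indepP _ _)) => -[B hB sI].
  move: hB; rewrite bases_mdual => /imsetP[B' hB' eB].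
  by exists B'; rewrite // -eB.
by exists (ground M :\: B); rewrite // bases_mdual imset_f.
Qed.

Lemma munionC M N : munion M N = munion N M.
Proof.
by apply: eq_indep => [|I]; rewrite ?ground_munion 1?setUC // !indep_munion union_indepC.
Qed.

Lemma munionA M N L : munion M (munion N L) = munion (munion M N) L.
Proof.
apply: eq_indep => [|I]; first by rewrite !ground_munion setUA.
rewrite !indep_munion; apply/imset2P/imset2P.
  case=> X W hX; rewrite indep_munion => /imset2P[Y Z hY hZ ->] ->.
  by exists (X :|: Y) Z; rewrite ?setUA // indep_munion imset2_f.
case=> W Z; rewrite indep_munion => /imset2P[X Y hX hY ->] hZ ->.
by exists X (Y :|: Z); rewrite ?setUA // indep_munion imset2_f.
Qed.

Lemma minterC M N : minter M N = minter N M.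
Proof. by rewrite /minter munionC. Qed.

(** Intersection is dual to union, and union is visibly associative on
    independent sets; this lets an intersection inside a correspondence be moved to
    its argument. *)
Lemma minterA M N L : minter M (minter N L) = minter (minter M N) L.
Proof. by rewrite /minter !mdualK munionA. Qed.

(** In general the bases of a deletion are the maximal traces of bases. Once some
    basis avoids A, traces of smaller cardinal are not maximal, and only the
    bases avoiding A survive. *)
Lemma bases_mdelete_coindep M A B0 :
  B0 \in bases M -> [disjoint B0 & A] ->
  bases (mdelete M A) = [set B in bases M | [disjoint B & A]].
Proof.
move=> hB0 dB0; apply/setP => B; rewrite [RHS]inE; apply/idP/andP.
  move=> hB; move: (bases_indep hB); rewrite indep_mdelete inE => /andP[iB dB].
  split=> //; apply: (basis_of_card iB hB0).
  suff hB0' : B0 \in indep (mdelete M A) by case: (indep_card hB0' hB).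
  by rewrite indep_mdelete inE bases_indep.
case=> hB dB; apply: basis_of_max_card.
  by rewrite indep_mdelete inE bases_indep.
move=> I; rewrite indep_mdelete inE => /andP[hI _].
by case: (indep_card hI hB).
Qed.

(** Complementing in the dual, deleting A from the dual leaves the cobases that
    avoid A, that is, the bases that contain A; there are such bases because A is
    independent. *)
Lemma indep_mcontract M A I : A \in indep M -> [disjoint I & A] ->
  (I \in indep (mcontract M A)) = (A :|: I \in indep M).
Proof.
move=> /indepP[B0 hB0 AB0] dIA.
have hC0 : ground M :\: B0 \in bases (mdual M) by rewrite bases_mdual imset_f.
have dC B : A \subset B -> [disjoint ground M :\: B & A].
  by move=> s; rewrite -setI_eq0 setIDAC setD_eq0 subIset // s orbT.
have bE := bases_mdelete_coindep hC0 (dC _ AB0).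
apply/indep_mdualP/indepP; rewrite ground_mdelete ground_mdual.
  case=> C; rewrite bE inE mem_bases_mdual => /andP[/andP[sC hC] dCA] sI.
  exists (ground M :\: C) => //; rewrite subUset !subsetD [X in _ && X && _]disjoint_sym dCA.
  rewrite (subset_trans AB0 (bases_sub hB0)) /=.
  by move: sI; rewrite !subsetD -andbA => /and3P[-> _ ->].
case=> B hB; rewrite subUset => /andP[AB IB]; exists (ground M :\: B).
  by rewrite bE inE dC // andbT bases_mdual imset_f.
rewrite !subsetD (subset_trans IB (bases_sub hB)) dIA /=.
by rewrite disjoints_subset setCD subsetU // IB orbT.
Qed.

(** The complement of the union of B and C is the intersection of their
    complements, so a pair covering G has disjoint complementary cobases. The
    union of two cobases has at most r elements, r being the sum of the two
    coranks, with equality exactly when the cobases are disjoint. If some pair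
    reaches r, all bases of the union of the duals have r elements, so they
    come from covering pairs and from nothing else. *)
Lemma bases_minter_cover M N (G : {set T}) B0 C0 :
  ground M = G -> ground N = G ->
  B0 \in bases M -> C0 \in bases N -> B0 :|: C0 = G ->
  forall D, reflect
    (exists B C, [/\ B \in bases M, C \in bases N, B :|: C = G & D = B :&: C])
    (D \in bases (minter M N)).
Proof.
move=> eM eN hB0 hC0 cov0.
pose r := #|G :\: B0| + #|G :\: C0|.
have sM B : B \in bases M -> B \subset G by rewrite -eM; apply: bases_sub.
have sN C : C \in bases N -> C \subset G by rewrite -eN; apply: bases_sub.
have cE B C : B \in bases M -> C \in bases N -> #|G :\: B| + #|G :\: C| = r.
  move=> hB hC; rewrite /r !cardsDS ?(sM _ hB, sM _ hB0, sN _ hC, sN _ hC0) //.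
  by rewrite (card_bases hB hB0) (card_bases hC hC0).
have cardI B C : B \in bases M -> C \in bases N ->
    #|(G :\: B) :|: (G :\: C)| + #|G :\: (B :|: C)| = r.
  by move=> hB hC; rewrite -(cE _ _ hB hC) setDUr cardsUI.
have uB B C : B \in bases M -> C \in bases N ->
    (G :\: B) :|: (G :\: C) \in indep (munion (mdual M) (mdual N)).
  move=> hB hC; rewrite indep_munion; apply: imset2_f.
    by apply: bases_indep; rewrite bases_mdual eM imset_f.
  by apply: bases_indep; rewrite bases_mdual eN imset_f.
have cov W : W \in indep (munion (mdual M) (mdual N)) -> exists B C,
    [/\ B \in bases M, C \in bases N & W \subset (G :\: B) :|: (G :\: C)].
  rewrite indep_munion => /imset2P[I J /indep_mdualP[B hB sI] /indep_mdualP[C hC sJ] ->].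
  by exists B, C; rewrite eM in sI; rewrite eN in sJ; rewrite setUSS.
have eU : ground (munion (mdual M) (mdual N)) = G.
  by rewrite ground_munion !ground_mdual eM eN setUid.
have bU B C : B \in bases M -> C \in bases N -> B :|: C = G ->
    (G :\: B) :|: (G :\: C) \in bases (munion (mdual M) (mdual N)).
  move=> hB hC eG; apply: (basis_of_max_card (uB _ _ hB hC)) => W.
  case/cov=> B' [C' [hB' hC' /subset_leq_card sW]]; apply: leq_trans sW _.
  have := cardI _ _ hB hC; rewrite eG setDv cards0 addn0 => ->.
  by rewrite -(cardI _ _ hB' hC') leq_addr.
move=> D; rewrite /minter mem_bases_mdual eU; apply: (iffP andP).
  case=> sD hW; have [B [C [hB hC sW]]] := cov _ (bases_indep hW).
  have eW := basis_indep_eq hW (uB _ _ hB hC) sW.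
  have eC : B :|: C = G.
    apply/eqP; rewrite eqEsubset subUset sM // sN //= -setD_eq0 -cards_eq0.
    have := cardI _ _ hB hC; rewrite eW (card_bases hW (bU _ _ hB0 hC0 cov0)).
    have := cardI _ _ hB0 hC0; rewrite cov0 setDv cards0 addn0 => ->.
    by rewrite -[RHS]addn0 => /addnI ->.
  exists B, C; split=> //; rewrite -(setDDK sD) -eW -setDIr setDDK //.
  by rewrite subIset // (sM _ hB).
case=> B [C [hB hC eG ->]]; rewrite subIset ?(sM _ hB) //; split=> //.
by rewrite setDIr bU.
Qed.

End Generalities.

(** * Direct sums, free extensions and correspondences *)

Section DirectSums.
Variable T : finType.
Implicit Types (M N L : matroid T) (A B C D F I J W : {set T}).

Lemma eq_bases_indep M N : bases M = bases N -> indep M = indep N.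
Proof. by rewrite /indep => ->. Qed.

Lemma bases_mdsum_boolean M F : [disjoint ground M & F] ->
  bases (mdsum M (mboolean F)) = [set B :|: F | B in bases M].
Proof.
move=> d; rewrite bases_mdsum ?ground_of_bases // bases_mboolean.
apply/setP=> D; apply/imset2P/imsetP => [[B F' hB]|[B hB ->]].
  by rewrite inE => /eqP -> ->; exists B.
by exists B F; rewrite ?inE.
Qed.

Lemma bases_mdsum_empty M F : [disjoint ground M & F] ->
  bases (mdsum M (muniform 0 F)) = bases M.
Proof.
move=> d; rewrite bases_mdsum ?ground_of_bases // bases_muniform //.
apply/setP=> D; apply/imset2P/idP => [[B F' hB]|hD].
  by rewrite inE cards_eq0 => /andP[_ /eqP ->] ->; rewrite setU0.
by exists D set0; rewrite ?setU0 // inE sub0set cards0.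
Qed.

(** The dual of a Boolean summand consists of loops. Loops do not affect unions,
    which is why direct sums with Boolean matroids disappear on the dual side. *)
Lemma mdual_mdsum_boolean M F : [disjoint ground M & F] ->
  mdual (mdsum M (mboolean F)) = mdsum (mdual M) (muniform 0 F).
Proof.
move=> d; apply: matroid_eq.
  by rewrite ground_mdual !ground_mdsum ground_mdual !ground_of_bases.
rewrite bases_mdsum_empty ?ground_mdual // !bases_mdual bases_mdsum_boolean //.
rewrite -imset_comp ground_mdsum ground_of_bases.
apply: eq_imset => B /=; apply/setP => x; rewrite !inE.
by case xM: (x \in ground M); case: (x \in B); rewrite //= ?(disjointFr d xM) ?andNb.
Qed.

Lemma indep_mdual_mdsum_boolean M F : [disjoint ground M & F] ->
  indep (mdual (mdsum M (mboolean F))) = indep (mdual M).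
Proof.
move=> d; rewrite mdual_mdsum_boolean //.
by apply: eq_bases_indep; rewrite bases_mdsum_empty ?ground_mdual.
Qed.

(** On the dual side both members are the union of the duals of M and N, with the
    elements of F added as loops. *)
Lemma mdsum_minter_boolean M N F :
  ground M = ground N -> [disjoint ground M & F] ->
  mdsum (minter M N) (mboolean F) =
  minter (mdsum M (mboolean F)) (mdsum N (mboolean F)).
Proof.
move=> eMN dM; have dN := dM; rewrite eMN in dN.
have dMN : [disjoint ground (minter M N) & F] by rewrite ground_minter eMN setUid.
rewrite -[LHS]mdualK [in RHS]/minter; congr (mdual _).
apply: eq_indep => [|I].
  rewrite ground_mdual ground_munion ground_mdsum ground_minter ground_of_bases.
  rewrite (ground_mdual (mdsum M _)) (ground_mdual (mdsum N _)).
  by rewrite (ground_mdsum M) (ground_mdsum N) ground_of_bases setUUl.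
rewrite (indep_mdual_mdsum_boolean dMN) [minter M N]/minter mdualK.
by rewrite !indep_munion /union_indep (indep_mdual_mdsum_boolean dM) (indep_mdual_mdsum_boolean dN).
Qed.

Lemma indep_mfree_ext_base M t I : t \notin ground M -> t \notin I ->
  (I \in indep (mfree_ext M t)) = (I \in indep M).
Proof.
move=> tM tI; apply/indepP/indepP; rewrite bases_mfree_ext //; last first.
  by case=> B hB sI; exists B; rewrite // inE hB.
case=> B; rewrite inE => /orP[hB sI|/imset2P[B' x hB' _ ->] sI]; first by exists B.
exists B' => //; apply/subsetP => y yI; have := subsetP sI y yI.
by rewrite !inE => /orP[/eqP e|/andP[]//]; rewrite e (negbTE tI) in yI.
Qed.

(** The bases through t are obtained by exchanging one element of a basis for t,
    so t can be added to I exactly when I misses an element of a basis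
    containing it. *)
Lemma indep_mfree_ext_point M t I : t \notin ground M -> t \notin I ->
  (t |: I \in indep (mfree_ext M t)) = (I \in indep M) && (I \notin bases M).
Proof.
move=> tM tI; apply/indepP/andP; rewrite bases_mfree_ext //.
  case=> B; rewrite inE subUset sub1set => /orP[hB|/imset2P[B' x hB' hx ->]] /andP[tB sI].
    by rewrite (subsetP (bases_sub hB) _ tB) in tM.
  have sI' : I \subset B' :\ x.
    apply/subsetP => y yI; have := subsetP sI y yI.
    by rewrite !inE => /orP[/eqP e|//]; rewrite e (negbTE tI) in yI.
  split; first by apply/indepP; exists B'; rewrite // (subset_trans sI') ?subsetDl.
  apply: contraL (subset_leq_card sI') => hI.
  by rewrite (card_bases hI hB') [#|B'|](cardsD1 x) hx ltnn.
case=> /indepP[B hB sI] nI.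
have [x xB xI] : exists2 x, x \in B & x \notin I.
  by apply/subsetPn; apply: contra nI => s; rewrite -(_ : B = I) //; apply/eqP; rewrite eqEsubset s.
exists (t |: (B :\ x)).
  by rewrite inE; apply/orP; right; apply/imset2P; exists B x.
apply: setUS; apply/subsetP => y yI; rewrite !inE (subsetP sI) // andbT.
by apply: contraNneq xI => <-.
Qed.

End DirectSums.

Section Correspondences.
Variables (T : finType) (E1 E2 : {set T}) (C M : matroid T).
Hypotheses (dE : [disjoint E1 & E2]) (gC : ground C = E1 :|: E2)
  (gM : ground M = E1).
Implicit Types B I X : {set T}.

Lemma ground_mcorr : ground (mcorr E1 E2 C M) = E2.
Proof.
rewrite ground_mdelete ground_minter ground_mdsum ground_of_bases gC gM setUid.
by rewrite setDUl setDv set0U; apply/setDidPl; rewrite disjoint_sym.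
Qed.

(** Since E1 is independent in C, some basis of C contains E1 and covers the ground
    set together with B and E2 for any basis B of M. The intersection is then
    described by covering pairs, and a basis K of C covers with the union of B and E2 exactly
    when K contains the complement of B in E1. *)
Lemma indep_mcorrP I : E1 \in indep C -> I \subset E2 ->
  I \in indep (mcorr E1 E2 C M) <->
  exists2 B, B \in bases M & (E1 :\: B) :|: I \in indep C.
Proof.
move=> /indepP[C0 hC0 sC0] sI; have [B0 hB0] := bases_neq0 M.
have dM : [disjoint ground M & E2] by rewrite gM.
have dI : [disjoint I & E1] by rewrite disjoint_sym (disjointWr sI dE).
rewrite indep_mdelete inE dI andbT.
have sC K : K \in bases C -> K \subset E1 :|: E2 by rewrite -gC; apply: bases_sub.
have sM B : B \in bases M -> B \subset E1 by rewrite -gM; apply: bases_sub.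
have hB B : B \in bases M -> B :|: E2 \in bases (mdsum M (mboolean E2)).
  by move=> h; rewrite bases_mdsum_boolean //; apply/imsetP; exists B.
have cov B K : B \in bases M -> K \in bases C -> E1 :\: B \subset K ->
    (B :|: E2) :|: K = E1 :|: E2.
  move=> h1 h2 s; apply/setP => x; apply/idP/idP.
    rewrite -setUA !inE => /orP[/(subsetP (sM _ h1)) ->//|/orP[->|]].
      by rewrite orbT.
    by move=> /(subsetP (sC _ h2)); rewrite inE.
  rewrite !inE => /orP[xE|->]; last by rewrite orbT.
  by case xB: (x \in B); rewrite //= (subsetP s) ?orbT // inE xB.
have gA : ground (mdsum M (mboolean E2)) = E1 :|: E2.
  by rewrite ground_mdsum ground_of_bases gM.
have c0 := cov _ _ hB0 hC0 (subset_trans (subsetDl _ _) sC0).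
have bP := bases_minter_cover gA gC (hB _ hB0) hC0 c0.
split=> [/indepP[D /bP[A [K [hA hK eK ->]]]]|[B h1 /indepP[K hK]]].
  move: hA eK; rewrite bases_mdsum_boolean // => /imsetP[B h1 ->] eK.
  rewrite subsetI => /andP[_ sK]; exists B => //; apply/indepP; exists K => //.
  rewrite subUset sK andbT; apply/subsetP => x; rewrite inE => /andP[xB xE].
  have : x \in (B :|: E2) :|: K by rewrite eK inE xE.
  by rewrite !inE (negbTE xB) (disjointFr dE xE).
rewrite subUset => /andP[s1 s2]; apply/indepP; exists ((B :|: E2) :&: K).
  by apply/bP; exists (B :|: E2), K; split; auto.
by rewrite subsetI s2 andbT (subset_trans sI) // subsetUr.
Qed.

(** The dual of the image of M is the contraction by E1 of the union of the dual of
    M (with loops on E2) and the dual of C. When E1 is independent in the dual of C,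
    testing X amounts to splitting the union of E1 and X, and one may always let a
    cobasis of M cover as much of E1 as it can, leaving B and X to the dual of C.
    This applies to contractions of the identity correspondence, where
    E1 is coindependent but not independent. *)
Lemma indep_mdual_mcorrP X : E1 \in indep (mdual C) -> X \subset E2 ->
  X \in indep (mdual (mcorr E1 E2 C M)) <->
  exists2 B, B \in bases M & B :|: X \in indep (mdual C).
Proof.
move=> hE sX; have dX : [disjoint X & E1] by rewrite disjoint_sym (disjointWr sX dE).
have dM : [disjoint ground M & E2] by rewrite gM.
have sM B : B \in bases M -> B \subset E1 by rewrite -gM; apply: bases_sub.
rewrite [mdual _]/(mcontract _ _) indep_mcontract //; last first.
  rewrite indep_munion -[E1]set0U; apply: imset2_f => //; exact: indep0.
rewrite indep_munion /union_indep indep_mdual_mdsum_boolean //.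
split=> [/imset2P[P Q /indep_mdualP[B hB sP] hQ e]|[B hB hX]].
  exists B => //; apply: indep_sub hQ; rewrite gM subsetD in sP.
  have /andP[sP1 dP] := sP; apply/subsetP => x xBX.
  have : x \in P :|: Q.
    rewrite -e; move: xBX; rewrite !inE => /orP[/(subsetP (sM _ hB)) ->//|->].
    by rewrite orbT.
  rewrite inE => /orP[xP|//]; move: xBX; rewrite inE (disjointFr dP xP) /=.
  by move=> /(disjointFr dX); rewrite (subsetP sP1).
apply/imset2P; exists (E1 :\: B) (B :|: X) => //.
  by apply/indep_mdualP; exists B; rewrite // gM.
rewrite setUA; congr (_ :|: _); apply/setP => x; rewrite !inE.
by case xB: (x \in B); rewrite ?(subsetP (sM _ hB) _ xB) //= orbF.
Qed.

End Correspondences.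

(** * Copies of matroids and the identity correspondence *)

Lemma mem_imset_in (T T' : finType) (f : T -> T') (D J : {set T}) x :
  {in D &, injective f} -> J \subset D -> x \in D -> (f x \in f @: J) = (x \in J).
Proof.
move=> finj /subsetP sJ xD; apply/imsetP/idP => [[y yJ e]|]; last by exists x.
by rewrite (finj _ _ xD (sJ _ yJ) e).
Qed.

Lemma imsetS_in (T T' : finType) (f : T -> T') (D J K : {set T}) :
  {in D &, injective f} -> J \subset D -> K \subset D ->
  (f @: J \subset f @: K) = (J \subset K).
Proof.
move=> finj sJ sK; apply/idP/idP => [/subsetP s|]; last exact: imsetS.
apply/subsetP => x xJ; rewrite -(mem_imset_in finj sK) ?(subsetP sJ) //.
by apply: s; apply: imset_f.
Qed.

Lemma imsetD_in (T T' : finType) (f : T -> T') (D J K : {set T}) :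
  {in D &, injective f} -> J \subset D -> K \subset D ->
  f @: (J :\: K) = f @: J :\: f @: K.
Proof.
move=> finj sJ sK; apply/setP => y; rewrite inE.
apply/imsetP/andP => [[x]|[nK /imsetP[x xJ e]]].
  rewrite inE => /andP[xK xJ] ->.
  by rewrite (mem_imset_in finj sK) ?(subsetP sJ) // imset_f.
exists x; rewrite // inE xJ andbT; apply: contra nK => xK.
by rewrite e imset_f.
Qed.

Lemma subset_imset_pre (T T' : finType) (f : T -> T') (D : {set T}) (I : {set T'}) :
  I \subset f @: D -> exists2 J : {set T}, J \subset D & I = f @: J.
Proof.
move=> /subsetP sI; exists [set x in D | f x \in I].
  by apply/subsetP => x; rewrite inE => /andP[].
apply/setP => y; apply/idP/imsetP => [yI|[x]]; last by rewrite inE => /andP[_ h] ->.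
by case/imsetP: (sI _ yI) => x xD e; exists x; rewrite // inE xD -e.
Qed.

Section Copies.
Variables (T T' : finType) (f : T -> T').
Implicit Types (M : matroid T) (N : matroid T').

Lemma indep_mimage M (J : {set T}) : {in ground M &, injective f} ->
  J \subset ground M -> (f @: J \in indep (mimage f M)) = (J \in indep M).
Proof.
move=> finj sJ; apply/indepP/indepP; rewrite bases_mimage //.
  case=> _ /imsetP[B hB ->]; rewrite (imsetS_in finj sJ (bases_sub hB)) => s.
  by exists B.
by case=> B hB s; exists (f @: B); [apply: imset_f|apply: imsetS].
Qed.

Lemma eq_mimage M N : {in ground M &, injective f} ->
  ground N = f @: ground M ->
  (forall J : {set T}, J \subset ground M ->
     (f @: J \in indep N) = (J \in indep M)) ->
  N = mimage f M.
Proof.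
move=> finj gN hN; have gI : ground (mimage f M) = f @: ground M.
  exact: ground_of_bases.
apply: eq_indep => [|I]; first by rewrite gI.
case: (boolP (I \subset f @: ground M)) => [/subset_imset_pre[J sJ ->]|nI].
  by rewrite hN // indep_mimage.
by apply/idP/idP => /indep_ground; rewrite ?gN ?gI (negbTE nI).
Qed.

Lemma mdual_mimage M : {in ground M &, injective f} ->
  mdual (mimage f M) = mimage f (mdual M).
Proof.
move=> finj; have finj' : {in ground (mdual M) &, injective f}.
  by rewrite ground_mdual.
apply: matroid_eq; first by rewrite ground_mdual !ground_of_bases.
rewrite bases_mdual !bases_mimage // bases_mdual -!imset_comp ground_of_bases.
by apply: eq_in_imset => B hB /=; rewrite (imsetD_in finj) // bases_sub.
Qed.

(** The variant for matroids known through their duals: the copy along f commutes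
    with duality. *)
Lemma eq_mimage_mdual M N : {in ground M &, injective f} ->
  ground N = f @: ground M ->
  (forall J : {set T}, J \subset ground M ->
     (f @: J \in indep (mdual N)) = (J \in indep (mdual M))) ->
  N = mimage f M.
Proof.
move=> finj gN hN; apply: (can_inj (@mdualK T')); rewrite mdual_mimage //.
by apply: eq_mimage; rewrite ?ground_mdual.
Qed.

End Copies.

Lemma mimage_comp (T T' T'' : finType) (f : T -> T') (g : T' -> T'')
    (M : matroid T) :
  {in ground M &, injective f} -> {in f @: ground M &, injective g} ->
  mimage g (mimage f M) = mimage (g \o f) M.
Proof.
move=> finj ginj.
have gfinj : {in ground M &, injective (g \o f)}.
  by move=> x y hx hy /ginj-/(_ (imset_f _ hx) (imset_f _ hy)); apply: finj.
apply: matroid_eq; first by rewrite !ground_of_bases imset_comp.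
rewrite !bases_mimage ?ground_of_bases // -imset_comp.
by apply: eq_imset => B /=; rewrite imset_comp.
Qed.

Section Pairing.
Variables (T : finType) (E : {set T}) (g : T -> T).
Hypotheses (ginj : {in E &, injective g}) (dE : [disjoint E & g @: E]).
Implicit Types (J K S B I X : {set T}) (M : matroid T).

Lemma mem_pair_left K J x : J \subset E -> x \in E ->
  (x \in K :|: g @: J) = (x \in K).
Proof.
by move=> sJ xE; rewrite inE (disjointFr (disjointWr (imsetS g sJ) dE) xE) orbF.
Qed.

Lemma mem_pair_right K J x : K \subset E -> J \subset E -> x \in E ->
  (g x \in K :|: g @: J) = (x \in J).
Proof.
move=> sK sJ xE; rewrite inE (mem_imset_in ginj sJ xE).
by rewrite (disjointFl (disjointWl sK dE)) // imset_f.
Qed.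

Lemma pair_subset K J K' J' :
  K \subset E -> J \subset E -> K' \subset E -> J' \subset E ->
  (K :|: g @: J \subset K' :|: g @: J') = (K \subset K') && (J \subset J').
Proof.
move=> sK sJ sK' sJ'; apply/idP/andP => [/subsetP s|[s s']]; last first.
  by apply: setUSS => //; apply: imsetS.
split; apply/subsetP => x xX.
  have xE := subsetP sK _ xX.
  by rewrite -(mem_pair_left K' sJ' xE) s // inE xX.
have xE := subsetP sJ _ xX.
by rewrite -(mem_pair_right sK' sJ' xE) s // inE imset_f ?orbT.
Qed.

Lemma pair_diff K J K' J' :
  K \subset E -> J \subset E -> K' \subset E -> J' \subset E ->
  (K :|: g @: J) :\: (K' :|: g @: J') = (K :\: K') :|: g @: (J :\: J').
Proof.
move=> sK sJ sK' sJ'; rewrite (imsetD_in ginj sJ sJ').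
apply/setP => x; rewrite !inE; case xE: (x \in E).
  have nJ X : X \subset E -> (x \in g @: X) = false.
    by move=> sX; rewrite (disjointFr (disjointWr (imsetS g sX) dE) xE).
  by rewrite !nJ //= !orbF.
have nK X : X \subset E -> (x \in X) = false.
  by move=> sX; apply/negP => /(subsetP sX); rewrite xE.
by rewrite (nK K) // (nK K') //.
Qed.

(** A basis is a transversal of the pairs x, g x with x in E. Phrased this way the
    condition is symmetric in the two members of a pair and local at each x, which makes
    the exchange axiom a check at each pair. *)
Lemma pair_basisP B :
  reflect (B \subset E :|: g @: E /\ {in E, forall x, (g x \in B) = (x \notin B)})
          (B \in [set S :|: g @: (E :\: S) | S in powerset E]).
Proof.
apply: (iffP imsetP) => [[S]|[sB hB]].
  rewrite powersetE => sS ->; have sD := subsetDl E S; split.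
    by rewrite setUSS // imsetS.
  by move=> x xE; rewrite mem_pair_right // mem_pair_left // inE xE andbT.
have sI := subsetIr B E; have sD := subsetDl E (B :&: E).
exists (B :&: E); rewrite ?powersetE //; apply/setP => x.
case xE: (x \in E); first by rewrite mem_pair_left // inE xE andbT.
apply/idP/idP => [xB|].
  have := subsetP sB _ xB; rewrite inE xE => /imsetP[z zE e]; rewrite e.
  rewrite mem_pair_right // !inE zE !andbT -hB // -e //.
rewrite !inE xE andbF => /imsetP[z]; rewrite !inE => /andP[h zE] ->.
by move: h; rewrite zE andbT hB.
Qed.

(** If u lies in one transversal and not in another, replacing u by the other member
    of its pair moves the first transversal towards the second. *)
Lemma corr_id_basis_axiom :
  basis_axiom (E :|: g @: E) [set S :|: g @: (E :\: S) | S in powerset E].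
Proof.
have gE x : x \in E -> (g x \in E) = false.
  by move=> xE; rewrite (disjointFl dE) // imset_f.
have gN x y : x \in E -> y \in E -> (x == g y) = false.
  by move=> xE yE; apply/eqP => e; rewrite e gE in xE.
apply/and3P; split.
- apply/set0Pn; exists (set0 :|: g @: (E :\: set0)); apply/imsetP.
  by exists set0; rewrite // powersetE sub0set.
- by apply/forall_inP => B /pair_basisP[].
apply/forall_inP => B1 /pair_basisP[s1 h1]; apply/forall_inP => B2 /pair_basisP[s2 h2].
apply/forall_inP => u; rewrite inE => /andP[u2 u1].
have := subsetP s1 _ u1; rewrite inE => /orP[uE|/imsetP[z zE e]].
  apply/exists_inP; exists (g u); first by rewrite inE h1 // h2 // u1.
  apply/pair_basisP; split=> [|x xE].
    rewrite subUset sub1set inE imset_f ?orbT //=.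
    by rewrite (subset_trans (subsetDl _ _) s1).
  rewrite !inE (gN _ _ xE uE) [g x == u]eq_sym (gN _ _ uE xE) /= h1 //.
  have -> : (g x == g u) = (x == u) by apply/eqP/eqP => [/ginj->|->].
  by case: (x == u).
have {}u1 : z \notin B1 by rewrite -h1 // -e.
have {}u2 : z \in B2 by rewrite e h2 // negbK in u2.
apply/exists_inP; exists z; first by rewrite inE u1 u2.
apply/pair_basisP; split=> [|x xE].
  rewrite subUset sub1set inE zE //=.
  by rewrite (subset_trans (subsetDl _ _) s1).
rewrite !inE e (gN _ _ xE zE) [g x == z]eq_sym (gN _ _ zE xE) /= h1 //.
have -> : (g x == g z) = (x == z) by apply/eqP/eqP => [/ginj->|->].
by case: (x == z).
Qed.

Lemma bases_corr_id :
  bases (corr_id E g) = [set S :|: g @: (E :\: S) | S in powerset E].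
Proof. exact: bases_of_bases corr_id_basis_axiom. Qed.

Lemma ground_corr_id : ground (corr_id E g) = E :|: g @: E.
Proof. exact: ground_of_bases. Qed.

Lemma pair_basis K J : K \subset E -> J \subset E ->
  (K :|: g @: J \in bases (corr_id E g)) = (J == E :\: K).
Proof.
move=> sK sJ; rewrite bases_corr_id; apply/imsetP/eqP => [[S]|->]; last first.
  by exists K; rewrite ?powersetE.
rewrite powersetE => sS /eqP; rewrite eqEsubset !pair_subset ?subsetDl //.
move=> /andP[/andP[s1 s2] /andP[s3 s4]].
have -> : K = S by apply/eqP; rewrite eqEsubset s1.
by apply/eqP; rewrite eqEsubset s2.
Qed.

Lemma pair_indep K J : K \subset E -> J \subset E ->
  (K :|: g @: J \in indep (corr_id E g)) = [disjoint K & J].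
Proof.
move=> sK sJ; apply/indepP/idP => [[B]|d].
  rewrite bases_corr_id => /imsetP[S]; rewrite powersetE => sS ->.
  rewrite pair_subset ?subsetDl // subsetD => /andP[s1 /andP[_ d]].
  by rewrite disjoint_sym (disjointWr s1 d).
exists ((E :\: J) :|: g @: J).
  by rewrite pair_basis ?subsetDl // setDDr setDv set0U (setIidPr sJ).
by apply: setSU; rewrite subsetD sK.
Qed.

Lemma pair_indep_excl I x : I \in indep (corr_id E g) -> x \in E ->
  x \in I -> g x \notin I.
Proof.
move=> hI xE xI; apply/negP => gxI.
have : [set x] :|: g @: [set x] \in indep (corr_id E g).
  by apply: indep_sub hI; rewrite imset_set1 subUset !sub1set xI.
by rewrite pair_indep ?sub1set // disjoints1 inE eqxx.
Qed.

(** The complement of a transversal of the pairs is again a transversal. *)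
Lemma mdual_corr_id : mdual (corr_id E g) = corr_id E g.
Proof.
apply: matroid_eq; first by rewrite ground_mdual.
apply/setP => B; rewrite mem_bases_mdual ground_corr_id.
apply/andP/idP => [[sB]|hB].
  rewrite bases_corr_id => /imsetP[S]; rewrite powersetE => sS e.
  rewrite -(setDDK sB) e pair_diff ?subsetDl // setDDK //.
  by rewrite -bases_corr_id pair_basis ?subsetDl // setDDK.
split; first by rewrite -ground_corr_id bases_sub.
move: hB; rewrite bases_corr_id => /imsetP[S]; rewrite powersetE => sS ->.
rewrite pair_diff ?subsetDl // setDDK //.
by rewrite -bases_corr_id pair_basis ?subsetDl // setDDK.
Qed.

Lemma corr_id_domain_indep : E \in indep (corr_id E g).
Proof.
by rewrite -[X in X \in _]setU0 -(imset0 g) pair_indep ?sub0set // disjoint_sym disjoints_subset sub0set.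
Qed.

Lemma disjoint_complement J B : J \subset E ->
  [disjoint E :\: B & J] = (J \subset B).
Proof.
move=> sJ; apply/idP/idP => [d|s]; last first.
  by rewrite disjoint_sym disjoints_subset setCD (subset_trans s) // subsetUr.
apply/subsetP => x xJ; apply/negPn/negP => xB.
by have := disjointFl d xJ; rewrite inE xB (subsetP sJ).
Qed.

(** The criterion asks that the complement of some basis B be disjoint from J,
    that is, that J be contained in B. It is stated for any injection g of E into its
    complement, so that it also covers permutations of the ground set. *)
Lemma mcorr_corr_id M : ground M = E ->
  mcorr E (g @: E) (corr_id E g) M = mimage g M.
Proof.
move=> gM; have gE := ground_corr_id.
apply: eq_mimage; rewrite gM //; first by rewrite (ground_mcorr dE gE gM).
move=> J sJ; apply/idP/indepP.
  case/(indep_mcorrP dE gE gM corr_id_domain_indep (imsetS g sJ)) => B hB.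
  by rewrite pair_indep ?subsetDl // disjoint_complement // => s; exists B.
case=> B hB s.
apply/(indep_mcorrP dE gE gM corr_id_domain_indep (imsetS g sJ)); exists B => //.
by rewrite pair_indep ?subsetDl // disjoint_complement.
Qed.

End Pairing.

(** * Matroid operations as correspondences *)

Section Parts.
Variables (T : finType) (E : {set T}) (star : T -> T).
Hypotheses (star_inj : {in E &, injective star})
  (star_disj : [disjoint E & star @: E]).
Implicit Types (B I J K S X : {set T}) (M : matroid T).

Let gid := ground_corr_id E star.

Section Permutation.
Variable s : {perm T}.
Hypothesis sE : perm_on E s.

Lemma imset_comp_perm J : (star \o s) @: J = star @: (s @: J).
Proof. exact: imset_comp. Qed.

Lemma comp_perm_inj : {in E &, injective (star \o s)}.
Proof.
move=> x y xE yE /star_inj e; apply: (@perm_inj _ s); apply: e.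
  by rewrite perm_closed.
by rewrite perm_closed.
Qed.

Lemma perm_pair_family :
  [set S :|: star @: (E :\: s @: S) | S in powerset E] =
  [set S :|: (star \o s) @: (E :\: S) | S in powerset E].
Proof.
apply: eq_in_imset => S; rewrite powersetE => sS; rewrite imset_comp_perm.
have sinj : {in E &, injective s} by move=> x y _ _; apply: perm_inj.
by rewrite (imsetD_in sinj (subxx E) sS) (im_perm_on sE).
Qed.

(** Permuting the ground set only changes the matching of E with its copy: x is
    paired with star (s x) instead of star x. *)
Lemma corr_perm_id : corr_perm E star s = corr_id E (star \o s).
Proof.
rewrite /corr_perm /corr_id perm_pair_family.
by rewrite imset_comp_perm (im_perm_on sE).
Qed.

Lemma bases_corr_perm : bases (corr_perm E star s) =
  [set S :|: star @: (E :\: s @: S) | S in powerset E].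
Proof.
rewrite perm_pair_family corr_perm_id bases_corr_id //.
  exact: comp_perm_inj.
by rewrite imset_comp_perm (im_perm_on sE).
Qed.

Lemma mcorr_corr_perm M : ground M = E ->
  mcorr E (star @: E) (corr_perm E star s) M = mimage star (mimage s M).
Proof.
move=> gM; rewrite corr_perm_id mimage_comp ?gM ?(im_perm_on sE) //; last first.
  by move=> x y _ _; apply: perm_inj.
have -> : star @: E = (star \o s) @: E by rewrite imset_comp_perm (im_perm_on sE).
apply: mcorr_corr_id => //; first exact: comp_perm_inj.
by rewrite imset_comp_perm (im_perm_on sE).
Qed.

End Permutation.

Section Point.
Variable e : T.
Hypothesis eE : e \in E.

Let sub_e : E :\ e \subset E. Proof. exact: subsetDl. Qed.
Let inj_e : {in E :\ e &, injective star}.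
Proof. by move=> x y /(subsetP sub_e) hx /(subsetP sub_e); apply: star_inj. Qed.
Let disj_e : [disjoint E & star @: (E :\ e)].
Proof. exact: disjointWr (imsetS star sub_e) star_disj. Qed.

Lemma pair_without_star : (E :|: star @: E) :\: [set star e] = E :|: star @: (E :\ e).
Proof.
have sub1 : [set e] \subset E by rewrite sub1set.
rewrite -imset_set1 -[star @: [set e]]set0U (pair_diff star_inj star_disj) ?sub0set //.
by rewrite setD0.
Qed.

Lemma disjoint_star_point K J : K \subset E -> J \subset E ->
  [disjoint K :|: star @: J & [set star e]] = (e \notin J).
Proof.
by move=> sK sJ; rewrite disjoint_sym disjoints1 (mem_pair_right star_inj star_disj).
Qed.

Lemma bases_corr_delete :
  bases (mdelete (corr_id E star) [set star e]) =
  [set S :|: star @: (E :\: S) | S in powerset E & e \in S].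
Proof.
have hE : E :|: star @: set0 \in bases (corr_id E star).
  by rewrite pair_basis ?sub0set // setDv.
have dE0 : [disjoint E :|: star @: set0 & [set star e]].
  by rewrite disjoint_star_point ?sub0set ?inE.
rewrite (bases_mdelete_coindep hE dE0) bases_corr_id //.
apply/setP => B; rewrite inE; apply/andP/imsetP => [[/imsetP[S]]|[S]].
  rewrite powersetE => sS ->; rewrite disjoint_star_point ?subsetDl //.
  by rewrite !inE eE andbT negbK => eS; exists S; rewrite // !inE sS.
rewrite !inE => /andP[sS eS] ->; split; first by apply: imset_f; rewrite powersetE.
by rewrite disjoint_star_point ?subsetDl // inE eS.
Qed.

(** E, containing e, is independent in this correspondence, so the criterion applies;
    the sets it tests are those of the identity case that avoid star e. *)
Lemma mcorr_delete M : ground M = E ->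
  mcorr E (star @: (E :\ e)) (mdelete (corr_id E star) [set star e]) M =
  mimage star (mdelete M [set e]).
Proof.
move=> gM; have gC : ground (mdelete (corr_id E star) [set star e]) =
    E :|: star @: (E :\ e) by rewrite ground_mdelete gid pair_without_star.
have hC K J : K \subset E -> J \subset E :\ e ->
    (K :|: star @: J \in indep (mdelete (corr_id E star) [set star e])) =
    [disjoint K & J].
  move=> sK; rewrite subsetD1 => /andP[sJ eJ].
  by rewrite indep_mdelete inE pair_indep // disjoint_star_point // eJ andbT.
have hE : E \in indep (mdelete (corr_id E star) [set star e]).
  by rewrite -[X in X \in _]setU0 -(imset0 star) hC ?sub0set // -setI_eq0 setI0.
have gMe : ground (mdelete M [set e]) = E :\ e by rewrite ground_mdelete gM.
apply: eq_mimage; rewrite gMe //; first by rewrite (ground_mcorr disj_e gC gM).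
move=> J sJ; have [sJE eJ] := andP (etrans (esym (subsetD1 _ _ _)) sJ).
rewrite (indep_mdelete M) [in RHS]inE disjoint_sym disjoints1 eJ andbT.
have P := indep_mcorrP disj_e gC gM hE (imsetS star sJ).
apply/idP/indepP => [/P[B hB]|[B hB sB]].
  by rewrite hC ?subsetDl // disjoint_complement // => sB; exists B.
by apply/P; exists B; rewrite // hC ?subsetDl // disjoint_complement.
Qed.

Lemma mdual_corr_contract :
  mdual (mcontract (corr_id E star) [set star e]) =
  mdelete (corr_id E star) [set star e].
Proof. by rewrite /mcontract mdualK mdual_corr_id. Qed.

Lemma ground_corr_contract :
  ground (mcontract (corr_id E star) [set star e]) = E :|: star @: (E :\ e).
Proof. by rewrite ground_mcontract gid pair_without_star. Qed.

Lemma bases_corr_contract :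
  bases (mcontract (corr_id E star) [set star e]) =
  [set S :|: star @: (E :\: (e |: S)) | S in powerset (E :\ e)].
Proof.
rewrite /mcontract mdual_corr_id // bases_mdual bases_corr_delete.
rewrite ground_mdelete gid pair_without_star.
have comp S : S \subset E -> e \in S ->
    (E :|: star @: (E :\ e)) :\: (S :|: star @: (E :\: S)) =
    (E :\: S) :|: star @: (E :\: (e |: (E :\: S))).
  move=> sS eS; rewrite (pair_diff star_inj star_disj) ?subsetDl //.
  suff -> : (E :\ e) :\: (E :\: S) = E :\: (e |: (E :\: S)) by [].
  by rewrite -setDDl.
apply/setP => B; apply/imsetP/imsetP => [[D /imsetP[S]]|[S]].
  rewrite !inE => /andP[sS eS] -> ->; exists (E :\: S); last exact: comp.
  by rewrite powersetE subsetD1 subsetDl inE eS.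
rewrite powersetE subsetD1 => /andP[sS eS] ->.
have eD : e \in E :\: S by rewrite inE eS.
exists ((E :\: S) :|: star @: (E :\: (E :\: S))).
  by apply/imsetP; exists (E :\: S); rewrite // !inE subsetDl eS.
by rewrite comp ?subsetDl // setDDK.
Qed.

(** Here E is not independent in the correspondence, since no basis of it contains
    e, but E is a basis of its dual, which is the identity correspondence
    without star e. The dual criterion then compares the duals of both sides. *)
Lemma mcorr_contract M : ground M = E ->
  mcorr E (star @: (E :\ e)) (mcontract (corr_id E star) [set star e]) M =
  mimage star (mcontract M [set e]).
Proof.
move=> gM; have gC := ground_corr_contract.
have hC K J : K \subset E -> J \subset E :\ e ->
    (K :|: star @: J \in
      indep (mdual (mcontract (corr_id E star) [set star e]))) =
    [disjoint K & J].
  rewrite mdual_corr_contract => sK; rewrite subsetD1 => /andP[sJ eJ].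
  by rewrite indep_mdelete inE pair_indep // disjoint_star_point // eJ andbT.
have hE : E \in indep (mdual (mcontract (corr_id E star) [set star e])).
  by rewrite -[X in X \in _]setU0 -(imset0 star) hC ?sub0set // -setI_eq0 setI0.
have gMe : ground (mcontract M [set e]) = E :\ e by rewrite ground_mcontract gM.
apply: eq_mimage_mdual; rewrite gMe //; first by rewrite (ground_mcorr disj_e gC gM).
move=> J sJ; have [sJE eJ] := andP (etrans (esym (subsetD1 _ _ _)) sJ).
rewrite [mdual (mcontract M _)]mdualK (indep_mdelete (mdual M)) [in RHS]inE.
rewrite disjoint_sym disjoints1 eJ andbT.
have P := indep_mdual_mcorrP disj_e gM hE (imsetS star sJ).
have sub B : B \in bases M -> B \subset E by rewrite -gM; apply: bases_sub.
apply/idP/indep_mdualP => [/P[B hB]|[B hB]]; rewrite gM.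
  by rewrite hC ?sub // disjoint_sym => d; exists B; rewrite // subsetD sJE.
rewrite subsetD disjoint_sym => /andP[_ d].
by apply/P; exists B; rewrite // hC ?sub.
Qed.

End Point.

Section FreeExtension.
Variable t : T.
Hypothesis tE : t \notin E :|: star @: E.

Let tE1 : t \notin E. Proof. by move: tE; rewrite inE negb_or => /andP[]. Qed.
Let tE2 : t \notin star @: E. Proof. by move: tE; rewrite inE negb_or => /andP[]. Qed.
Let f := [eta star with t |-> t].

Lemma free_copyE J : J \subset E -> f @: J = star @: J.
Proof.
move=> sJ; apply: eq_in_imset => x /(subsetP sJ) xE /=.
by case: eqP => // e; move: tE1; rewrite -e xE.
Qed.

Lemma free_copyU J : J \subset E -> f @: (t |: J) = t |: star @: J.
Proof. by move=> sJ; rewrite imsetU1 free_copyE //= eqxx. Qed.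

Lemma free_copy_inj : {in t |: E &, injective f}.
Proof.
have nt x : x \in E -> f x = star x /\ star x != t.
  move=> xE; split => /=.
    by case: eqP => // e; move: tE1; rewrite -e xE.
  by apply: contraNneq tE2 => <-; apply: imset_f.
have ft : f t = t by rewrite /= eqxx.
move=> x y; rewrite !inE => /predU1P[->|xE] /predU1P[->|yE] //.
- by have [-> n] := nt y yE; rewrite ft => e; rewrite -e eqxx in n.
- by have [-> n] := nt x xE; rewrite ft => e; rewrite e eqxx in n.
by rewrite (nt x xE).1 (nt y yE).1; apply: star_inj.
Qed.

(** Exchanging star e for t with e outside S, or exchanging an element e of S for t:
    both kinds drop one pair, and the second is the first for the set S without e. *)
Lemma bases_corr_free : bases (mfree_ext (corr_id E star) t) =
  [set S :|: star @: (E :\: S) | S in powerset E] :|: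
  [set t |: (S :|: star @: (E :\: (e |: S))) | S in powerset E, e in E :\: S].
Proof.
rewrite bases_mfree_ext ?gid // bases_corr_id //; congr (_ :|: _).
have rem_right S e : S \subset E -> e \in E :\: S ->
    (S :|: star @: (E :\: S)) :\ star e = S :|: star @: (E :\: (e |: S)).
  move=> sS eS; have eE : e \in E by move: eS; rewrite inE => /andP[].
  rewrite -imset_set1 -[star @: [set e]]set0U.
  rewrite (pair_diff star_inj star_disj) ?subsetDl ?sub0set ?sub1set //.
  by rewrite setD0 setDDl [S :|: [set e]]setUC.
have rem_left S e : S \subset E -> e \in S ->
    (S :|: star @: (E :\: S)) :\ e =
    (S :\ e) :|: star @: (E :\: (e |: (S :\ e))).
  move=> sS eS; have eE := subsetP sS _ eS.
  have sub1 : [set e] \subset E by rewrite sub1set.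
  have := pair_diff star_inj star_disj sS (subsetDl E S) sub1 (sub0set E).
  by rewrite imset0 setU0 => ->; rewrite setD0 setD1K.
apply/setP => B; apply/imset2P/imset2P => [[D x /imsetP[S]]|[S e]].
  rewrite powersetE => sS ->; rewrite inE => /orP[xS|/imsetP[e eS ->]] ->.
    exists (S :\ x) x; rewrite ?powersetE ?(subset_trans (subsetDl _ _)) //.
      by rewrite !inE eqxx (subsetP sS).
    by rewrite rem_left.
  by exists S e; rewrite ?powersetE // rem_right.
rewrite powersetE => sS eS ->.
exists (S :|: star @: (E :\: S)) (star e).
- by apply: imset_f; rewrite powersetE.
- by rewrite inE imset_f ?orbT.
by rewrite rem_right.
Qed.

(** A set containing t is tested on its other elements J, which together with the
    complement of B must be independent in the identity correspondence without
    being a basis of it: J must be a proper subset of B. *)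
Lemma mcorr_free M : ground M = E ->
  mcorr E (t |: star @: E) (mfree_ext (corr_id E star) t) M =
  mimage f (mfree_ext M t).
Proof.
move=> gM; pose C := mfree_ext (corr_id E star) t.
have gC : ground C = E :|: (t |: star @: E).
  by rewrite ground_of_bases gid setUCA.
have dE2 : [disjoint E & t |: star @: E].
  by rewrite disjoint_sym -setI_eq0 setIUl setU_eq0 !setI_eq0 disjoints1 tE1 disjoint_sym.
have tC : t \notin ground (corr_id E star) by rewrite gid.
have tM : t \notin ground M by rewrite gM.
have tP K J : K \subset E -> J \subset E -> t \notin K :|: star @: J.
  by move=> sK sJ; apply: contra tE; apply/subsetP; rewrite setUSS // imsetS.
have hE : E \in indep C.
  by rewrite indep_mfree_ext_base // corr_id_domain_indep.
have gF : ground (mfree_ext M t) = t |: E by rewrite ground_of_bases gM.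
have sMB B : B \in bases M -> B \subset E by rewrite -gM; apply: bases_sub.
apply: eq_mimage; rewrite gF; first exact: free_copy_inj.
  by rewrite (ground_mcorr dE2 gC gM) free_copyU.
move=> J sJ; case tJ: (t \in J); last first.
  have {}sJ : J \subset E.
    apply/subsetP => x xJ; have := subsetP sJ x xJ; rewrite !inE.
    by case/predU1P => // e; rewrite e tJ in xJ.
  rewrite free_copyE // indep_mfree_ext_base ?tJ //.
  have sJ2 : star @: J \subset t |: star @: E.
    by rewrite (subset_trans (imsetS _ sJ)) ?subsetUr.
  have P := indep_mcorrP dE2 gC gM hE sJ2.
  apply/idP/indepP => [/P[B hB]|[B hB sB]].
    rewrite indep_mfree_ext_base ?tP ?subsetDl // pair_indep ?subsetDl //.
    by rewrite disjoint_complement // => sB; exists B.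
  apply/P; exists B; rewrite // indep_mfree_ext_base ?tP ?subsetDl //.
  by rewrite pair_indep ?subsetDl // disjoint_complement.
pose L := J :\ t; have tL : t \notin L by rewrite !inE eqxx.
have sL : L \subset E.
  apply/subsetP => x; rewrite !inE => /andP[xt xJ]; have := subsetP sJ x xJ.
  by rewrite !inE (negbTE xt).
have -> : J = t |: L by rewrite setD1K.
rewrite free_copyU // indep_mfree_ext_point //.
have P := indep_mcorrP dE2 gC gM hE (setUS [set t] (imsetS star sL)).
have key B : B \in bases M ->
    ((E :\: B) :|: (t |: star @: L) \in indep C) = (L \subset B) && (L != B).
  move=> hB; rewrite setUCA indep_mfree_ext_point ?tP ?subsetDl //.
  rewrite pair_indep ?pair_basis ?subsetDl // disjoint_complement //.
  by rewrite setDDK ?sMB.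
apply/idP/andP => [/P[B hB]|[/indepP[B hB sB] nL]].
  rewrite key // => /andP[sB nB]; split; first by apply/indepP; exists B.
  apply: contra nB => hL; rewrite eqEcard sB.
  by rewrite (card_bases hB hL) leqnn.
apply/P; exists B; rewrite // key // sB.
by apply: contraNneq nL => ->.
Qed.

End FreeExtension.

(** Associativity turns an intersection inside the correspondence into an
    intersection of the argument, and the identity case applies. *)
Lemma mcorr_inter M0 M : ground M0 = E -> ground M = E ->
  mcorr E (star @: E)
    (minter (corr_id E star) (mdsum M0 (mboolean (star @: E)))) M =
  mimage star (minter M M0).
Proof.
move=> gM0 gM; have gI : ground (minter M M0) = E.
  by rewrite ground_minter gM gM0 setUid.
rewrite -(mcorr_corr_id star_inj star_disj gI).
rewrite /mcorr mdsum_minter_boolean ?gM //.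
by rewrite [minter (corr_id _ _) _]minterC minterA.
Qed.

(** K meets J in the x whose pair lies entirely in the set under test; these pairs
    are what the identity cannot accommodate and M0 must absorb. With K the complement of a basis B of M, this
    leaves the elements of J outside B to M0. *)
Lemma mcorr_union M0 M : ground M0 = E -> ground M = E ->
  mcorr E (star @: E)
    (munion (corr_id E star) (mdsum M0 (muniform 0 (star @: E)))) M =
  mimage star (munion M M0).
Proof.
move=> gM0 gM; set C := munion _ _.
have d0 : [disjoint ground M0 & star @: E] by rewrite gM0.
have gC : ground C = E :|: star @: E.
  by rewrite ground_munion gid ground_mdsum ground_of_bases gM0 setUid.
have sM0 I : I \in indep M0 -> I \subset E by rewrite -gM0; apply: indep_ground.
have hC K J : K \subset E -> J \subset E ->
    (K :|: star @: J \in indep C) = (K :&: J \in indep M0).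
  move=> sK sJ; rewrite indep_munion /union_indep.
  rewrite (eq_bases_indep (bases_mdsum_empty d0)).
  apply/imset2P/idP => [[I1 I2 h1 h2 e]|h].
    apply: (indep_sub _ h2); apply/subsetP => x; rewrite inE => /andP[xK xJ].
    have xE := subsetP sK _ xK.
    have : x \in I1 :|: I2 by rewrite -e inE xK.
    rewrite inE orbC => /orP[//|/(pair_indep_excl star_inj star_disj h1 xE) n].
    have : star x \in I1 :|: I2 by rewrite -e inE imset_f ?orbT.
    rewrite inE (negbTE n) /= => /(subsetP (sM0 _ h2)) sxE.
    by have := disjointFr star_disj sxE; rewrite imset_f.
  exists ((K :\: J) :|: star @: J) (K :&: J) => //.
    rewrite pair_indep // ?(subset_trans (subsetDl _ _)) //.
    by rewrite -setI_eq0 setIDAC setDIl setDv setI0.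
  by rewrite setUAC [K :\: J :|: _]setUC setID.
have hE : E \in indep C.
  by rewrite -[X in X \in _]setU0 -(imset0 star) hC ?sub0set // setI0 indep0.
have gU : ground (munion M M0) = E by rewrite ground_munion gM gM0 setUid.
apply: eq_mimage; rewrite gU //; first by rewrite (ground_mcorr star_disj gC gM).
move=> J sJ; have P := indep_mcorrP star_disj gC gM hE (imsetS star sJ).
rewrite indep_munion; apply/idP/imset2P => [/P[B hB]|[I1 I2 /indepP[B hB sB] h2 e]].
  rewrite hC ?subsetDl // => h; exists (J :&: B) ((E :\: B) :&: J) => //.
    by apply/indepP; exists B; rewrite // subsetIr.
  by rewrite setIDAC (setIidPr sJ) setID.
apply/P; exists B; rewrite // hC ?subsetDl //; apply: indep_sub h2.
apply/subsetP => x; rewrite e !inE => /andP[/andP[xB _] /orP[/(subsetP sB)|//]].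
by rewrite (negbTE xB).
Qed.

End Parts.

(** The criterion holds with any basis of M, since the elements of E1 are
    coloops of the correspondence. *)
Lemma mcorr_constant (T : finType) (E1 E2 : {set T}) (M0 M : matroid T) :
  [disjoint E1 & E2] -> ground M0 = E2 -> ground M = E1 ->
  mcorr E1 E2 (mdsum (mboolean E1) M0) M = M0.
Proof.
move=> d g0 gM; set C := mdsum _ _.
have gC : ground C = E1 :|: E2 by rewrite ground_mdsum ground_of_bases g0.
have bC B : B \in bases M0 -> E1 :|: B \in bases C.
  move=> hB; rewrite bases_mdsum ?ground_of_bases ?g0 // bases_mboolean.
  by apply/imset2P; exists E1 B; rewrite ?inE.
have hE : E1 \in indep C.
  have [B hB] := bases_neq0 M0.
  by apply/indepP; exists (E1 :|: B); rewrite ?bC // subsetUl.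
apply: eq_indep => [|I]; first by rewrite (ground_mcorr d gC gM) g0.
case: (boolP (I \subset E2)) => [sI|nI]; last first.
  by apply/idP/idP => /indep_ground; rewrite ?(ground_mcorr d gC gM) ?g0 (negbTE nI).
have P := indep_mcorrP d gC gM hE sI.
apply/idP/indepP => [/P[B hB /indepP[D]]|[B hB sB]].
  rewrite bases_mdsum ?ground_of_bases ?g0 // bases_mboolean.
  case/imset2P => E1' B0; rewrite inE => /eqP -> hB0 ->.
  rewrite subUset => /andP[_ s]; exists B0 => //; apply/subsetP => x xI.
  have := subsetP s x xI; rewrite inE => /orP[xE|//].
  by have := disjointFr d xE; rewrite (subsetP sI).
have [B1 hB1] := bases_neq0 M; apply/P; exists B1 => //.
by apply/indepP; exists (E1 :|: B); rewrite ?bC // setUSS // subsetDl.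
Qed.

Theorem theorem3p1 (T : finType) (E : {set T}) (star : T -> T)
    (star_inj : {in E &, injective star})
    (star_disj : [disjoint E & star @: E]) :
  (* (1) identity *)
  (ground (corr_id E star) = E :|: star @: E /\
   bases (corr_id E star) =
     [set S :|: star @: (E :\: S) | S in powerset E] /\
   forall M : matroid T, ground M = E ->
     mcorr E (star @: E) (corr_id E star) M = mimage star M) /\
  (* (2) permutation of the ground set *)
  (forall s : {perm T}, perm_on E s ->
   ground (corr_perm E star s) = E :|: star @: E /\
   bases (corr_perm E star s) =
     [set S :|: star @: (E :\: s @: S) | S in powerset E] /\
   forall M : matroid T, ground M = E ->
     mcorr E (star @: E) (corr_perm E star s) M = mimage star (mimage s M)) /\
  (* (3) deletion *)
  (forall e : T, e \in E ->
   let C := mdelete (corr_id E star) [set star e] in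
   ground C = E :|: star @: (E :\ e) /\
   bases C = [set S :|: star @: (E :\: S) | S in powerset E & e \in S] /\
   forall M : matroid T, ground M = E ->
     mcorr E (star @: (E :\ e)) C M = mimage star (mdelete M [set e])) /\
  (* (4) contraction *)
  (forall e : T, e \in E ->
   let C := mcontract (corr_id E star) [set star e] in
   ground C = E :|: star @: (E :\ e) /\
   bases C =
     [set S :|: star @: (E :\: (e |: S)) | S in powerset (E :\ e)] /\
   forall M : matroid T, ground M = E ->
     mcorr E (star @: (E :\ e)) C M = mimage star (mcontract M [set e])) /\
  (* (5) free extension; the copy of M +_E t keeps t fixed *)
  (forall t : T, t \notin E :|: star @: E ->
   let C := mfree_ext (corr_id E star) t in
   ground C = t |: (E :|: star @: E) /\
   bases C =
     [set S :|: star @: (E :\: S) | S in powerset E] :|: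
     [set t |: (S :|: star @: (E :\: (e |: S)))
        | S in powerset E, e in E :\: S] /\
   forall M : matroid T, ground M = E ->
     mcorr E (t |: star @: E) C M =
     mimage [eta star with t |-> t] (mfree_ext M t)) /\
  (* (6) intersection with a fixed matroid *)
  (forall M0 : matroid T, ground M0 = E ->
   let C := minter (corr_id E star) (mdsum M0 (mboolean (star @: E))) in
   ground C = E :|: star @: E /\
   forall M : matroid T, ground M = E ->
     mcorr E (star @: E) C M = mimage star (minter M M0)) /\
  (* (7) union with a fixed matroid *)
  (forall M0 : matroid T, ground M0 = E ->
   let C := munion (corr_id E star) (mdsum M0 (muniform 0 (star @: E))) in
   ground C = E :|: star @: E /\
   forall M : matroid T, ground M = E ->
     mcorr E (star @: E) C M = mimage star (munion M M0)) /\
  (* (8) constant map *)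
  (forall E1 E2 : {set T}, [disjoint E1 & E2] ->
   forall M0 : matroid T, ground M0 = E2 ->
   forall M : matroid T, ground M = E1 ->
     mcorr E1 E2 (mdsum (mboolean E1) M0) M = M0).
Proof.
have gid := ground_corr_id E star.
split; last split; last split; last split; last split; last split; last split.
- by rewrite bases_corr_id //; split=> //; split=> // M; apply: mcorr_corr_id.
- move=> s sE; split; first exact: ground_of_bases.
  split; first exact: bases_corr_perm.
  by move=> M; apply: mcorr_corr_perm.
- move=> e eE C; split; first by rewrite ground_mdelete gid pair_without_star.
  split; first exact: bases_corr_delete.
  by move=> M; apply: mcorr_delete.
- move=> e eE C; split; first exact: ground_corr_contract.
  split; first exact: bases_corr_contract.
  by move=> M; apply: mcorr_contract.
- move=> t tE C; split; first by rewrite ground_of_bases gid.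
  split; first exact: bases_corr_free.
  by move=> M; apply: mcorr_free.
- move=> M0 gM0 C; split; last by move=> M; apply: mcorr_inter.
  by rewrite ground_minter gid ground_mdsum ground_of_bases gM0 setUid.
- move=> M0 gM0 C; split; last by move=> M; apply: mcorr_union.
  by rewrite ground_munion gid ground_mdsum ground_of_bases gM0 setUid.
- by move=> E1 E2 d M0 gM0 M gM; apply: mcorr_constant.
Qed.
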